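(* Let $U(a,b,x)$ denote the confluent hypergeometric function of the second kind. Let $n\ge 2$ and suppose that $\boldsymbol{p}=(p_1,\dots,p_n)$, $\boldsymbol{q}=(q_1,\dots,q_n)\in(-a,\infty)^n$ satisfy $\boldsymbol{p}\prec\boldsymbol{q}$. For real $\rho$ let $$\mathcal{U}_\rho(x)=\prod_{j=1}^nU(a+p_j,b+p_j,x)-\rho\prod_{j=1}^nU(a+q_j,b+q_j,x).$$ Then the following statements are valid. (i) Let $a>0$, $b>1$ and $$\lambda_n^{\ast}=\prod_{j=1}^n\frac{\Gamma(b+p_j-1)\Gamma(a+q_j)}{\Gamma(b+q_j-1)\Gamma(a+p_j)}.$$ If $a-b+1>0$, then $x\mapsto\mathcal{U}_\rho(x)$ is completely monotonic on $(0,\infty)$ if and only if $\rho\le\lambda_n^{\ast}$; consequently the sharp inequality $\lambda_n^{\ast}<\prod_{j=1}^n\frac{U(a+p_j,b+p_j,x)}{U(a+q_j,b+q_j,x)}$ holds for $x>0$. If $a-b+1<0$, then $x\mapsto-\mathcal{U}_\rho(x)$ is completely monotonic on $(0,\infty)$ if and only if $\rho\ge\lambda_n^{\ast}$; consequently the sharp inequality $\lambda_n^{\ast}>\prod_{j=1}^n\frac{U(a+p_j,b+p_j,x)}{U(a+q_j,b+q_j,x)}$ holds for $x>0$. (ii) Let $a>0$. If $a-b+1>0$, then $x\mapsto-\mathcal{U}_\rho(x)$ is completely monotonic on $(0,\infty)$ if and only if $\rho\ge 1$; therefore the sharp inequality $\prod_{j=1}^n\frac{U(a+p_j,b+p_j,x)}{U(a+q_j,b+q_j,x)}<1$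 holds for $x>0$. If $a-b+1<0$, then $x\mapsto\mathcal{U}_\rho(x)$ is completely monotonic on $(0,\infty)$ if and only if $\rho\le 1$; therefore the sharp inequality $\prod_{j=1}^n\frac{U(a+p_j,b+p_j,x)}{U(a+q_j,b+q_j,x)}>1$ holds for $x>0$.
   Context: For $a>0$, $b\in\mathbb{R}$ and $x>0$, the confluent hypergeometric function of the second kind (Tricomi function) is $U(a,b,x)=\frac{1}{\Gamma(a)}\int_0^\infty t^{a-1}(1+t)^{b-a-1}e^{-xt}\,dt$. ''Sharp'' means that the constant in the inequality cannot be improved. A function $h$ is completely monotonic on an interval $I$ if it has derivatives of all orders on $I$ and $(-1)^m h^{(m)}(x)\ge 0$ for all integers $m\ge 0$ and all $x\in I$. For $x=(x_1,\dots,x_n)$ and $y=(y_1,\dots,y_n)$ in $\mathbb{R}^n$, $y\prec x$ means: $x\ne y$, $x_1\ge x_2\ge\cdots\ge x_n$, $y_1\ge y_2\ge\cdots\ge y_n$, $\sum_{j=1}^{m}x_j\ge\sum_{j=1}^{m}y_j$ for $m=1,\dots,n-1$, and $\sum_{j=1}^n x_j=\sum_{j=1}^n y_j$.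
   Formalization: In (i), case a-b+1>0, the condition b+q_j-1>0 for all j is added so that the Gammas in λ_n^* have positive arguments; without it the claim fails, e.g. a=3, b=3/2, q=(0,-2), p=(-1,-1) gives λ^*=6 while the ratio is <1 by (ii). *)

(* Defs.v *)
From HB Require Import structures.
From mathcomp Require Import all_boot all_order all_algebra.
From mathcomp Require Import all_classical all_reals all_analysis.

Set Implicit Arguments.
Unset Strict Implicit.
Unset Printing Implicit Defensive.

Import Order.TTheory GRing.Theory Num.Theory.
Import numFieldNormedType.Exports.

Local Open Scope classical_set_scope.
Local Open Scope ring_scope.

(* Meaningful for z > 0 only: otherwise the integral is +oo and
   [Rintegral] returns the junk value 0. *)
Definition Gamma (R : realType) (z : R) : R :=
  \int[lebesgue_measure]_(t in `]0, +oo[) (t `^ (z - 1) * expR (- t)).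

(* Meaningful for a > 0 and x > 0, where the integral converges. *)
Definition tricomiU (R : realType) (a b x : R) : R :=
  (Gamma a)^-1 *
  \int[lebesgue_measure]_(t in `]0, +oo[)
    (t `^ (a - 1) * (1 + t) `^ (b - a - 1) * expR (- (x * t))).

(* Intended for open I: the derivatives are the two-sided ones, which at a
   point of an open set depend only on the values of h on that set. *)
Definition completely_monotonic_on (R : realType) (I : set R) (h : R -> R) :
    Prop :=
  forall (m : nat) (x : R), I x ->
    derivable (derive1n m h) x 1 /\ 0 <= (-1) ^+ m * derive1n m h x.

(* [majorized y x] is y ≺ x: y is strictly below x (y <> x), and both
   vectors are required to be non-increasing. *)
Definition majorized (R : realType) (n : nat) (y x : 'rV[R]_n) : Prop :=
  [/\ x <> y,
      forall i j : 'I_n, (i <= j)%N -> x 0 j <= x 0 i,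
      forall i j : 'I_n, (i <= j)%N -> y 0 j <= y 0 i,
      forall m : nat, (1 <= m <= n.-1)%N ->
        \sum_(j < n | (j < m)%N) y 0 j <= \sum_(j < n | (j < m)%N) x 0 j
    & \sum_(j < n) x 0 j = \sum_(j < n) y 0 j].

Definition sharp_lower_bound_on (R : realType) (I : set R) (c : R)
    (f : R -> R) : Prop :=
  (forall x, I x -> c < f x) /\
  (forall c', (forall x, I x -> c' < f x) -> c' <= c).

Definition sharp_upper_bound_on (R : realType) (I : set R) (c : R)
    (f : R -> R) : Prop :=
  (forall x, I x -> f x < c) /\
  (forall c', (forall x, I x -> f x < c') -> c <= c').

Definition tricomi_diff (R : realType) (n : nat) (a b : R) (p q : 'rV[R]_n)
    (rho x : R) : R :=
  \prod_(j < n) tricomiU (a + p 0 j) (b + p 0 j) x -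
  rho * \prod_(j < n) tricomiU (a + q 0 j) (b + q 0 j) x.

Definition tricomi_ratio (R : realType) (n : nat) (a b : R) (p q : 'rV[R]_n)
    (x : R) : R :=
  \prod_(j < n) (tricomiU (a + p 0 j) (b + p 0 j) x /
                 tricomiU (a + q 0 j) (b + q 0 j) x).

Definition lambda_star (R : realType) (n : nat) (a b : R) (p q : 'rV[R]_n) :
    R :=
  \prod_(j < n) ((Gamma (b + p 0 j - 1) * Gamma (a + q 0 j)) /
                 (Gamma (b + q 0 j - 1) * Gamma (a + p 0 j))).

(* Main.v *)
Require Import Defs.
From HB Require Import structures.
From mathcomp Require Import all_boot all_order all_algebra.
From mathcomp Require Import all_classical all_reals all_analysis.
From mathcomp Require Import measurable_realfun lebesgue_integral_under.
From mathcomp Require Import ring lra.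

Set Implicit Arguments.
Unset Strict Implicit.
Unset Printing Implicit Defensive.

Import Order.TTheory GRing.Theory Num.Theory.
Import numFieldNormedType.Exports.

Local Open Scope classical_set_scope.
Local Open Scope ring_scope.

(** Write [c = b - a - 1].  Up to the factor [(Gamma al)^-1], the function
    [U(al, al + c + 1, x)] is the Laplace transform of the density
    [w_al(t) = t^(al-1) (1+t)^c] on [(0, +oo)], and all the functions in the
    statement are products of such transforms with the same [c].  A function is
    completely monotonic as soon as it is the Laplace transform of a nonnegative
    density, so everything reduces to showing that suitable differences of
    products have a positive density.

    For two factors, the density of the product at [r] is the convolution
    [int_0^r w_al(s) w_be(r-s) ds].  As [(1+s)(1+r-s) = 1 + r + s(r-s)], this is
    a Beta integral of [s^(al-1) (r-s)^(be-1)] against a function of the single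
    quantity [y = s(r-s)], namely [(1+r+y)^c].  One may also move a power
    [y^c] into the Beta kernel: with [e = 0] or [e = c] the integrand is
    [s^(al+e-1) (r-s)^(be+e-1)] times [y^(-e) (1+r+y)^c]
    ([conv_integrand_sym]).  The second factor is strictly monotonic in [y]; its
    direction is that of the sign of [c] when [e = 0] and the opposite one when
    [e = c] ([modulation_inc]), which is why the same argument gives part (ii)
    with [e = 0] and part (i) with [e = c].

    Once divided by [Gamma (al+e) Gamma (be+e)], the Beta kernels with a given
    sum [al + be] all have the same mass, by Euler's formula for the Beta
    integral ([tricomi_convolution0_Gamma]).  After symmetrization in
    [s <-> r-s], the quotient of the kernel of a pair [p1 >= p2] by the kernel
    of a more spread pair [q1 > p1 >= p2 > q2] is a quotient
    [cosh (d L) / cosh (d' L)] with [d < d'] and [L = ln (s/(r-s)) / 2], hence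
    strictly increasing in [y] ([sym_beta_kernel_ratio_lt]).  Two densities with
    equal mass and increasing quotient cross once, and integrating an increasing
    function of [y] against them gives strictly ordered values
    ([single_crossing]).  So the normalized products for the two pairs differ by
    the Laplace transform of a positive density
    ([pair_positive_laplace_transform]).

    A majorization is a succession of transfers that bring two entries closer
    ([transfer_induction]); each one multiplies a two-factor difference by
    common positive factors, and these differences add up
    ([majorized_positive_laplace_transform]).  This proves complete monotonicity
    for the critical constant, and strict inequality.  Sharpness comes from one
    end of the half-line: [x^(al+e)] times the normalized factor tends to 1 as
    [x] tends to infinity when [e = 0] and to 0 when [e = c], so the ratio of the
    normalized products tends to 1 there ([cvg_normalized_ratio]).  Undoing the
    normalization turns that limit into [1] for [e = 0] and [lambda_star] for
    [e = c]. *)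

Local Notation mu := lebesgue_measure.

(** * Laplace transforms and convolution *)

(** Both sides are measures that agree on intervals, which determine a Borel
    measure. *)
Lemma lebesgue_measure_affine (R : realType) (k b : R) (k0 : 0 < k)
    (A : set (measurableTypeR R)) : measurable A ->
  mu A = (k%:E * mu ((fun t => k * t + b)%R @^-1` A))%E.
Proof.
move=> mA.
have mf : measurable_fun setT (fun t : measurableTypeR R =>
    (k * t + b : measurableTypeR R)).
  by apply: measurable_funD => //; apply: measurable_funM.
pose f : {mfun measurableTypeR R >-> measurableTypeR R} :=
  HB.pack (fun t : measurableTypeR R => (k * t + b : measurableTypeR R))
    (isMeasurableFun.Build _ _ _ _ _ mf).
apply: (@lebesgue_measure_unique _ (mscale (NngNum (ltW k0)) (pushforward mu f))) => //.
move=> _ [[x y] _ <-].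
transitivity (k%:E * mu (`](x - b)%R / k, (y - b)%R / k]%classic%R : set R))%E; last first.
  congr (_ * mu _)%E; apply/esym/seteqP; split => t /=; rewrite !in_itv/= ltr_pdivrMr// ler_pdivlMr//;
  by rewrite ltrBlDr lerBrDr (mulrC t).
rewrite !lebesgue_measure_itv/= !lte_fin.
rewrite ltr_pM2r ?invr_gt0// ltrD2r.
case: ifPn => xy; last by rewrite mule0.
rewrite -!EFinB -EFinM; congr EFin; field.
by rewrite gt_eqF.
Qed.

Lemma ge0_integral_affine (R : realType) (k b : R) (f : R -> \bar R) : 0 < k ->
  measurable_fun setT f -> (forall t, 0 <= f t)%E ->
  (\int[mu]_t f t = k%:E * \int[mu]_t f (k * t + b)%R)%E.
Proof.
move=> k0 mf f0.
have mg : measurable_fun setT (fun t : measurableTypeR R =>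
    (k * t + b : measurableTypeR R)).
  by apply: measurable_funD => //; apply: measurable_funM.
pose g : {mfun measurableTypeR R >-> measurableTypeR R} :=
  HB.pack (fun t : measurableTypeR R => (k * t + b : measurableTypeR R))
    (isMeasurableFun.Build _ _ _ _ _ mg).
rewrite (eq_measure_integral (mscale (NngNum (ltW k0)) (pushforward mu g))); last first.
  by move=> A mA _; exact: lebesgue_measure_affine.
rewrite ge0_integral_mscale//=.
by rewrite ge0_integral_pushforward.
Qed.

Definition laplace (R : realType) (f : R -> \bar R) (x : R) : \bar R :=
  (\int[mu]_t (f t * (expR (- (x * t)))%:E))%E.

(** The integral runs over the whole line: for functions that vanish on
    [(-oo, 0]] the integrand is supported in [(0, r)], and translation
    invariance needs no bookkeeping of domains. *)
Definition convolution (R : realType) (f g : R -> \bar R) (r : R) : \bar R :=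
  (\int[mu]_s (f s * g (r - s)%R))%E.

Lemma measurable_convolution_kernel (R : realType) (f g : R -> \bar R) :
  measurable_fun setT f -> measurable_fun setT g ->
  measurable_fun setT (fun z : measurableTypeR R * measurableTypeR R =>
    (f z.1 * g (z.2 - z.1)%R)%E).
Proof.
move=> mf mg; apply: emeasurable_funM; first exact: measurableT_comp.
apply: (measurableT_comp mg).
by apply: measurable_funB; [exact: measurable_snd|exact: measurable_fst].
Qed.

Lemma measurable_convolution (R : realType) (f g : R -> \bar R) :
  measurable_fun setT f -> measurable_fun setT g ->
  (forall t, 0 <= f t)%E -> (forall t, 0 <= g t)%E ->
  measurable_fun setT (convolution f g).
Proof.
move=> mf mg f0 g0.
apply: (@measurable_fun_fubini_tonelli_G _ _ (measurableTypeR R)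
  (measurableTypeR R) R mu
  (fun z => (f z.1 * g (z.2 - z.1)%R)%E)).
  exact: measurable_convolution_kernel.
by move=> z; rewrite mule_ge0.
Qed.

Lemma convolution_ge0 (R : realType) (f g : R -> \bar R) r :
  (forall t, 0 <= f t)%E -> (forall t, 0 <= g t)%E ->
  (0 <= convolution f g r)%E.
Proof. by move=> f0 g0; apply: integral_ge0 => t _; rewrite mule_ge0. Qed.

Lemma measurable_expR_lin (R : realType) (x : R) :
  measurable_fun setT (fun t : R => (expR (- (x * t)))%:E).
Proof.
apply/measurable_EFinP; apply: measurableT_comp => //.
by apply: measurableT_comp => //; apply: measurable_funM.
Qed.

(** By Tonelli, after the translation [t = r - s] in the inner integral. *)
Lemma laplace_convolution (R : realType) (f g : R -> \bar R) x :
  measurable_fun setT f -> measurable_fun setT g ->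
  (forall t, 0 <= f t)%E -> (forall t, 0 <= g t)%E ->
  (laplace (convolution f g) x = laplace f x * laplace g x)%E.
Proof.
move=> mf mg f0 g0.
pose E (t : R) : \bar R := (expR (- (x * t)))%:E.
have E0 t : (0 <= E t)%E by rewrite lee_fin expR_ge0.
have mE : measurable_fun setT E by exact: measurable_expR_lin.
have Lg0 : (0 <= laplace g x)%E by apply: integral_ge0 => t _; rewrite mule_ge0.
transitivity (\int[mu]_r \int[mu]_s (f s * g (r - s)%R * E r))%E.
  apply: eq_integral => r _; rewrite /convolution -ge0_integralZr//.
    by apply: emeasurable_funM => //; apply: (measurableT_comp mg); exact: measurable_funB.
  by move=> s _; rewrite mule_ge0.
rewrite -(@fubini_tonelli _ _ (measurableTypeR R) (measurableTypeR R) R mu mu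
   (fun z => (f z.1 * g (z.2 - z.1)%R * E z.2)%E)) /=; last 2 first.
- apply: emeasurable_funM; first exact: measurable_convolution_kernel.
  exact: measurableT_comp.
- by move=> z; rewrite !mule_ge0.
have -> : (laplace f x * laplace g x = \int[mu]_s (laplace g x * (f s * E s)))%E.
  rewrite ge0_integralZl//; last 2 first.
  - exact: emeasurable_funM.
  - by move=> t _; rewrite mule_ge0.
  by rewrite muleC.
apply: eq_integral => s _.
rewrite (@ge0_integral_affine R 1 s) ?ltr01//; last 2 first.
- apply: emeasurable_funM => //; apply: emeasurable_funM => //.
  by apply: (measurableT_comp mg); exact: measurable_funB.
- by move=> t; rewrite !mule_ge0.
have -> : (laplace g x * (f s * E s) = \int[mu]_t ((f s * E s) * (g t * E t)))%E.
  rewrite ge0_integralZl//; last 3 first.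
  - exact: emeasurable_funM.
  - by move=> t _; rewrite mule_ge0.
  - by rewrite mule_ge0.
  by rewrite muleC.
rewrite mul1e; apply: eq_integral => t _.
rewrite mul1r addrK -!muleA; congr (_ * _)%E.
rewrite [RHS]muleC -muleA; congr (_ * _)%E.
by rewrite /E -EFinM -expRD; congr (expR _)%:E; ring.
Qed.

(** * The density of the Tricomi function *)

(** Extended by zero so that convolutions and Laplace transforms can be taken
    over the whole line. *)
Definition tricomi_density (R : realType) (c al t : R) : R :=
  if 0 < t then t `^ (al - 1) * (1 + t) `^ c else 0.

Section density.
Variable R : realType.
Implicit Types c al t x : R.

Lemma tricomi_density_ge0 c al t : 0 <= tricomi_density c al t.
Proof. by rewrite /tricomi_density; case: ifP => // _; rewrite mulr_ge0 ?powR_ge0. Qed.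

Lemma tricomi_density_gt0 c al t : 0 < t -> 0 < tricomi_density c al t.
Proof.
by move=> t0; rewrite /tricomi_density t0 mulr_gt0 ?powR_gt0 ?addr_gt0.
Qed.

Lemma tricomi_density_le0 c al t : t <= 0 -> tricomi_density c al t = 0.
Proof. by move=> t0; rewrite /tricomi_density ltNge t0. Qed.

Lemma measurable_tricomi_density c al : measurable_fun setT (tricomi_density c al).
Proof.
apply: measurable_fun_ifT => //.
  exact: measurable_fun_ltr.
apply: measurable_funM; first exact: measurable_powR.
apply: (@measurableT_comp _ _ _ _ _ _ (@powR R ^~ c)) => //.
exact: measurable_funD.
Qed.

(** Integrability at infinity: an exponential beats any power.  For [0 < c] this
    is [ln y < y] at [y = (u/c)(1+t)]. *)
Lemma powR_le_expR c (u : R) : 0 < u ->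
  exists2 C, 0 < C & forall t, 0 <= t -> (1 + t) `^ c <= C * expR (u * t).
Proof.
move=> u0; have [c0|c0] := leP c 0.
  exists 1 => // t t0; rewrite mul1r (@le_trans _ _ 1)//.
    by rewrite -[leRHS](powRr0 (1 + t)) ler_powR// lerDl.
  by rewrite -expR0 ler_expR mulr_ge0// ltW.
exists (expR (u - c * ln (u / c))); first exact: expR_gt0.
move=> t t0; have t1 : 0 < 1 + t by lra.
have uc0 : 0 < u / c by rewrite divr_gt0.
rewrite -expRD /powR gt_eqF// ler_expR.
have : ln (u / c * (1 + t)) <= u / c * (1 + t) by rewrite ltW// ln_sublinear// mulr_gt0.
rewrite lnM ?posrE// => h.
have : c * (ln (u / c) + ln (1 + t)) <= c * (u / c * (1 + t)) by rewrite ler_pM2l.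
have -> : c * (u / c * (1 + t)) = u * (1 + t) by field; rewrite gt_eqF.
by lra.
Qed.

Lemma continuous_powR (b : R) : forall y : R, 0 < y ->
  {for y, continuous (@powR R ^~ b)}.
Proof.
move=> y y0; apply: differentiable_continuous; apply/derivable1_diffP.
by apply: derivable_powR; rewrite in_itv/= andbT.
Qed.

(** The density with [c = - al - 1] is a multiple of the beta prime density with
    parameters [al] and 1, whose distribution function is [(t/(1+t))^al]. *)
Lemma is_derive_beta_prime_cdf al t : 0 < t ->
  is_derive t 1 (fun t => t `^ al * (1 + t) `^ (- al))
    (al * tricomi_density (- al - 1) al t).
Proof.
move=> t0; have t1 : 0 < 1 + t by lra.
have d1 : is_derive t 1 (fun t => t `^ al) (al * t `^ (al - 1)).
  exact: is_derive1_powR.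
have d2 : is_derive t 1 (fun t => (1 + t) `^ (- al)) (- al * (1 + t) `^ (- al - 1)).
  have da : is_derive t 1 (fun t : R => 1 + t) 1.
    apply: (is_derive_eq (is_deriveD (is_derive_cst (1 : R) t 1) (is_derive_id t 1))).
    by rewrite add0r.
  have := @is_derive1_comp _ (fun y => y `^ (- al)) (fun t => 1 + t) t
    (- al * (1 + t) `^ (- al - 1)) 1.
  by rewrite mulr1; apply => //; exact: is_derive1_powR.
have d12 := is_deriveM d1 d2.
apply: (is_derive_eq d12).
rewrite /tricomi_density t0 /GRing.scale/=.
have powRS (y b : R) : 0 < y -> y `^ b = y * y `^ (b - 1).
  move=> y0; rewrite powRB ?(gt_eqF y0) ?implybT// powRr1 ?ltW//.
  by rewrite mulrCA divff ?mulr1// gt_eqF.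
rewrite (powRS t al)// (powRS (1 + t) (- al))//.
ring.
Qed.

Lemma integral_support_oy (f : R -> \bar R) :
  (forall t, t <= 0 -> f t = 0%E) ->
  (\int[mu]_t f t = \int[mu]_(t in `]0%R, +oo[) f t)%E.
Proof.
move=> f0; rewrite [RHS]integral_mkcond; apply: eq_integral => t _.
rewrite patchE; case: ifPn => //; rewrite notin_setE/= in_itv/= andbT => /negP.
by rewrite -leNgt => /f0.
Qed.

(** This one integral settles integrability at 0 and at infinity together: a
    density with the same [al] and any [c], times a decaying exponential, is
    bounded by a multiple of this one. *)
Lemma integral_beta_prime_lty al : 0 < al ->
  (\int[mu]_t (tricomi_density (- al - 1) al t)%:E < +oo)%E.
Proof.
move=> al0; rewrite integral_support_oy; last first.
  by move=> t t0; rewrite tricomi_density_le0.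
(* exhaust the half-line by compact intervals on which the density is continuous *)
pose F (n : nat) : set R := `[n.+1%:R^-1, n.+2%:R]%classic.
have FU : `]0, +oo[%classic = \bigcup_n F n.
  apply/seteqP; split=> [t|t [n _]] /=; last first.
    by rewrite /F/= !in_itv/= andbT => /andP[h _]; rewrite (lt_le_trans _ h) ?invr_gt0.
  rewrite in_itv/= andbT => t0; exists (maxn (Num.truncn t) (Num.truncn t^-1)) => //.
  rewrite /F/= in_itv/=; apply/andP; split.
    rewrite invf_ple ?posrE//.
    apply: (le_trans (ltW (truncnS_gt _))); rewrite ler_nat ltnS.
    exact: leq_maxr.
  apply: (le_trans (ltW (truncnS_gt _))); rewrite ler_nat ltnS.
  exact: (leq_trans (leq_maxl _ _) (leqnSn _)).
pose k t := (tricomi_density (- al - 1) al t)%:E.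
have mk A : measurable_fun A k.
  by apply: measurable_funTS; apply/measurable_EFinP; exact: measurable_tricomi_density.
have k0 t : (0 <= k t)%E by rewrite lee_fin tricomi_density_ge0.
have ndF : nondecreasing_seq F.
  apply/nondecreasing_seqP => n; rewrite subsetEset; apply: subset_itv.
    by rewrite bnd_simp lef_pV2 ?posrE// ler_nat.
  by rewrite bnd_simp ler_nat.
have mF n : measurable (F n) by exact: measurable_itv.
have : (\int[mu]_(t in F i) k t)%E @[i --> \oo] --> (\int[mu]_(t in \bigcup_i F i) k t)%E.
  apply: ge0_nondecreasing_set_cvg_integral => // i; exact: mk.
rewrite -FU => /cvg_lim <-//.
apply: (@le_lt_trans _ _ (al^-1)%:E); last exact: ltry.
apply: lime_le.
  apply: ereal_nondecreasing_is_cvgn.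
  by apply: ge0_nondecreasing_set_nondecreasing_integral => // i; exact: mk.
apply: nearW => n /=.
pose G t : R := al^-1 * (t `^ al * (1 + t) `^ (- al)).
have dG t : 0 < t -> is_derive t 1 G (tricomi_density (- al - 1) al t).
  move=> t0; have := is_derive_beta_prime_cdf al t0 => dF.
  have dZ := is_deriveZ al^-1 dF.
  by apply: (is_derive_eq dZ); rewrite /GRing.scale/= mulKf// gt_eqF.
have ab : n.+1%:R^-1 < n.+2%:R :> R.
  rewrite (@le_lt_trans _ _ 1)//; first by rewrite invf_le1// ler1n.
  by rewrite ltr1n.
have a0 : 0 < n.+1%:R^-1 :> R by rewrite invr_gt0.
have Gle t : 0 < t -> 0 <= G t <= al^-1.
  move=> t0; rewrite /G mulr_ge0 ?invr_ge0 ?(ltW al0) ?mulr_ge0 ?powR_ge0//=.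
  rewrite -[leRHS]mulr1 ler_pM2l ?invr_gt0// powRN.
  rewrite ler_pdivrMr ?powR_gt0 ?mul1r; last lra.
  - by apply: ge0_ler_powR; rewrite ?nnegrE; lra.
  - by [].
have contG : forall y : R, 0 < y -> {for y, continuous G}.
  move=> y y_gt0; apply: differentiable_continuous; apply/derivable1_diffP.
  by have [] := dG _ y_gt0.
suff H : (\int[mu]_(t in F n) k t = (G n.+2%:R)%:E - (G n.+1%:R^-1)%:E)%E.
  rewrite H.
  rewrite -EFinB lee_fin.
  have /andP[_ h1] := Gle n.+2%:R (ltr0Sn _ _).
  have /andP[h2 _] := Gle n.+1%:R^-1 a0.
  by lra.
apply: continuous_FTC2 => //.
- apply: continuous_in_subspaceT => t; rewrite inE/= in_itv/= => /andP[at_ _].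
  have t0 : 0 < t by exact: lt_le_trans at_.
  have t1 : 0 < 1 + t by lra.
  have : {near t, (fun t => t `^ (al - 1) * (1 + t) `^ (- al - 1)) =1
     tricomi_density (- al - 1) al}.
    near=> s; rewrite /tricomi_density ifT//; near: s; exact: lt_nbhsr.
  move=> /near_eq_cvg h.
  rewrite /continuous_at/=; apply: cvg_trans h _.
  rewrite {1}/tricomi_density t0; apply: cvgM.
    exact: continuous_powR.
  apply: (@cvg_comp _ _ _ (fun t => 1 + t) (fun y => y `^ (- al - 1)) _ (nbhs (1 + t))).
    by apply: cvgD => //; exact: cvg_cst.
  exact: continuous_powR.
- split.
  + by move=> t; rewrite in_itv/= => /andP[at_ _]; have [] := dG _ (lt_trans a0 at_).
  + by apply: cvg_at_right_filter; exact: contG.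
  + by apply: cvg_at_left_filter; exact: contG (lt_trans a0 ab).
- move=> t; rewrite in_itv/= => /andP[at_ _].
  by rewrite derive1E; have [_ ->] := dG _ (lt_trans a0 at_).
Unshelve. all: by end_near. Qed.

End density.

(** * Gamma and Beta integrals *)

Definition tricomi_laplace (R : realType) (c al x : R) : R :=
  fine (laplace (fun t => (tricomi_density c al t)%:E) x).

Lemma ge0_integral_gt0 d (T : measurableType d) (R : realType)
    (nu : {measure set T -> \bar R}) (D : set T) (f : T -> \bar R) :
  measurable D -> (0 < nu D)%E -> measurable_fun D f ->
  {ae nu, forall t, D t -> (0 < f t)%E} -> (forall t, D t -> 0 <= f t)%E ->
  (0 < \int[nu]_(t in D) f t)%E.
Proof.
move=> mD D0 mf fpos f0; rewrite lt_def integral_ge0// andbT.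
apply/eqP => int0.
have : (\int[nu]_(t in D) `|f t| = 0)%E.
  by rewrite -int0; apply: eq_integral => t; rewrite inE => /f0/gee0_abs.
move/(ae_eq_integral_abs nu mD mf) => f_ae0.
have : (nu D <= 0)%E.
  have [N [mN N0 sub]] : nu.-negligible D.
    have : {ae nu, forall t, ~ D t}.
      apply: filterS2 f_ae0 fpos => t h1 h2 Dt.
      by have := h2 Dt; rewrite h1// ltxx.
    by move=> [N [mN N0 sub]]; exists N; split => // t Dt; apply: sub; apply.
  by rewrite -N0; apply: le_measure; rewrite ?inE.
by rewrite leNgt D0.
Qed.

Section laplace_density.
Variable R : realType.
Implicit Types c al t x : R.

Lemma measurable_EFin_tricomi_density c al :
  measurable_fun setT (fun t : R => (tricomi_density c al t)%:E).
Proof. by apply/measurable_EFinP; exact: measurable_tricomi_density. Qed.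

Lemma EFin_tricomi_density_ge0 c al t : (0 <= (tricomi_density c al t)%:E)%E.
Proof. by rewrite lee_fin tricomi_density_ge0. Qed.

Lemma measurable_laplace_integrand (f : R -> \bar R) x : measurable_fun setT f ->
  measurable_fun setT (fun t => f t * (expR (- (x * t)))%:E)%E.
Proof. by move=> mf; apply: emeasurable_funM => //; exact: measurable_expR_lin. Qed.

Lemma laplace_ge0 (f : R -> \bar R) x : (forall t, 0 <= f t)%E -> (0 <= laplace f x)%E.
Proof. by move=> f0; apply: integral_ge0 => t _; rewrite mule_ge0// lee_fin expR_ge0. Qed.

(** Finiteness by comparison with the beta prime density: the quotient
    [(1+t)^(c+al+1) exp(-xt)] is bounded. *)
Lemma laplace_tricomi_density_lty c al x : 0 < al -> 0 < x ->
  (laplace (fun t => (tricomi_density c al t)%:E) x < +oo)%E.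
Proof.
move=> al0 x0.
have [C C0 hC] := powR_le_expR (c + al + 1) x0.
apply: (@le_lt_trans _ _ (\int[mu]_t (C%:E * (tricomi_density (- al - 1) al t)%:E))%E).
  apply: ge0_le_integral => //.
  - by move=> t _; rewrite mule_ge0 ?EFin_tricomi_density_ge0// lee_fin expR_ge0.
  - apply: measurable_laplace_integrand; exact: measurable_EFin_tricomi_density.
  - apply: emeasurable_funM => //; exact: measurable_EFin_tricomi_density.
  - move=> t _; rewrite -!EFinM lee_fin /tricomi_density.
    case: ifPn => t0; last by rewrite mul0r mulr0.
    rewrite mulrCA -mulrA ler_pM2l ?powR_gt0//.
    have t1 : 0 < 1 + t by lra.
    have -> : c = (- al - 1) + (c + al + 1) by ring.
    rewrite powRD ?(gt_eqF t1) ?implybT// -mulrA mulrC ler_pM2r ?powR_gt0//.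
    by rewrite expRN ler_pdivrMr ?expR_gt0// hC// ltW.
rewrite ge0_integralZl//.
- by rewrite lte_mul_pinfty ?lee_fin ?(ltW C0)//; exact: integral_beta_prime_lty.
- exact: measurable_EFin_tricomi_density.
- by move=> t _; exact: EFin_tricomi_density_ge0.
- by rewrite lee_fin ltW.
Qed.

Lemma laplace_tricomi_density c al x : 0 < al -> 0 < x ->
  laplace (fun t => (tricomi_density c al t)%:E) x = (tricomi_laplace c al x)%:E.
Proof.
move=> al0 x0; rewrite /tricomi_laplace fineK// ge0_fin_numE.
  exact: laplace_tricomi_density_lty.
by apply: laplace_ge0 => t; exact: EFin_tricomi_density_ge0.
Qed.

Lemma lebesgue_measure_oy_gt0 : (0 < mu (`]0%R, +oo[%classic : set R))%E.
Proof. by rewrite lebesgue_measure_itv/= ltry sube0 ltry. Qed.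

Lemma laplace_gt0 (f : R -> \bar R) x : measurable_fun setT f ->
  (forall t, 0 <= f t)%E -> (forall t, t <= 0 -> f t = 0%E) ->
  (forall t, 0 < t -> (0 < f t)%E) -> (0 < laplace f x)%E.
Proof.
move=> mf f0 fN fP; rewrite /laplace integral_support_oy; last first.
  by move=> t t0; rewrite fN// mul0e.
apply: ge0_integral_gt0 => //.
- exact: lebesgue_measure_oy_gt0.
- by apply: measurable_funTS; exact: measurable_laplace_integrand.
- apply: aeW => t /=; rewrite in_itv/= andbT => t0.
  by rewrite mule_gt0 ?fP// lte_fin expR_gt0.
- by move=> t _; rewrite mule_ge0// lee_fin expR_ge0.
Qed.

Lemma tricomi_laplace_gt0 c al x : 0 < al -> 0 < x -> 0 < tricomi_laplace c al x.
Proof.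
move=> al0 x0; rewrite -lte_fin -laplace_tricomi_density//.
apply: laplace_gt0.
- exact: measurable_EFin_tricomi_density.
- by move=> t; exact: EFin_tricomi_density_ge0.
- by move=> t t0; rewrite tricomi_density_le0.
- by move=> t t0; rewrite lte_fin tricomi_density_gt0.
Qed.

Lemma tricomi_density0 al t : 0 < t -> tricomi_density 0 al t = t `^ (al - 1).
Proof. by move=> t0; rewrite /tricomi_density t0 powRr0 mulr1. Qed.

Lemma GammaE al : Gamma al = tricomi_laplace 0 al 1.
Proof.
rewrite /Gamma /tricomi_laplace /laplace /Rintegral; congr fine.
rewrite [RHS]integral_support_oy; last first.
  by move=> t t0; rewrite tricomi_density_le0// mul0e.
apply: eq_integral => t; rewrite inE/= in_itv/= andbT => t0.
by rewrite tricomi_density0// mul1r.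
Qed.

Lemma Gamma_gt0 al : 0 < al -> 0 < Gamma al.
Proof. by move=> al0; rewrite GammaE tricomi_laplace_gt0. Qed.

Lemma tricomiUE a b x : tricomiU a b x = (Gamma a)^-1 * tricomi_laplace (b - a - 1) a x.
Proof.
rewrite /tricomiU /tricomi_laplace /laplace /Rintegral; congr (_ * fine _).
rewrite [RHS]integral_support_oy; last first.
  by move=> t t0; rewrite tricomi_density_le0// mul0e.
apply: eq_integral => t; rewrite inE/= in_itv/= andbT => t0.
by rewrite /tricomi_density t0.
Qed.

Lemma laplace_tricomi_density_scale c al x : 0 < x ->
  laplace (fun t => (tricomi_density c al t)%:E) x =
  (x^-1%:E * \int[mu]_t ((tricomi_density c al (t / x))%:E * (expR (- t))%:E))%E.
Proof.
move=> x0.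
have xV0 : 0 < x^-1 by rewrite invr_gt0.
have m := measurable_laplace_integrand x (measurable_EFin_tricomi_density c al).
have k0 (t : R) : (0 <= (tricomi_density c al t)%:E * (expR (- (x * t)))%:E)%E.
  by rewrite mule_ge0 ?EFin_tricomi_density_ge0// lee_fin expR_ge0.
rewrite /laplace; have -> := @ge0_integral_affine R x^-1 0 _ xV0 m k0.
congr (_ * _)%E; apply: eq_integral => t _.
have -> : x^-1 * t + 0 = t / x by ring.
by rewrite (mulrCA x) divff ?gt_eqF// mulr1.
Qed.

Lemma tricomi_density_scale0 al (k t : R) : 0 < k ->
  tricomi_density 0 al (k * t) = k `^ (al - 1) * tricomi_density 0 al t.
Proof.
move=> k0; rewrite /tricomi_density pmulr_rgt0//; case: ifPn; last by rewrite mulr0.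
by move=> t0; rewrite !powRr0 !mulr1 powRM// ltW.
Qed.

Definition tricomi_convolution (c a b : R) : R -> \bar R :=
  convolution (fun t => (tricomi_density c a t)%:E) (fun t => (tricomi_density c b t)%:E).

(** Homogeneity, by the substitution of [r s] for [s]. *)
Lemma tricomi_convolution0_scale al be r : 0 < r ->
  (tricomi_convolution 0 al be r = (r `^ (al + be - 1))%:E * tricomi_convolution 0 al be 1)%E.
Proof.
move=> r0; rewrite /tricomi_convolution /convolution.
have mk (r' : R) : measurable_fun setT (fun s : R => (tricomi_density 0 al s)%:E *
    (tricomi_density 0 be (r' - s))%:E)%E.
  apply: emeasurable_funM; first exact: measurable_EFin_tricomi_density.
  apply: (measurableT_comp (measurable_EFin_tricomi_density 0 be)).
  exact: measurable_funB.
have k0 (r' s : R) : (0 <= (tricomi_density 0 al s)%:E *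
    (tricomi_density 0 be (r' - s))%:E)%E by rewrite mule_ge0 ?EFin_tricomi_density_ge0.
have -> := @ge0_integral_affine R r 0 _ r0 (mk r) (k0 r).
rewrite -[LHS]ge0_integralZl ?lee_fin ?(ltW r0)//; last first.
  apply: (measurableT_comp (mk r)).
  by apply: measurable_funD => //; exact: measurable_funM.
have E0 : (0 <= (r `^ (al + be - 1))%:E)%E by rewrite lee_fin powR_ge0.
have <- := @ge0_integralZl _ _ _ mu _ measurableT _ (mk 1) _ (fun s _ => k0 1 s) E0.
apply: eq_integral => s _; rewrite addr0.
have -> : r - r * s = r * (1 - s) by ring.
rewrite !tricomi_density_scale0// -!EFinM; congr EFin.
have -> : al + be - 1 = 1 + (al - 1) + (be - 1) by ring.
rewrite !powRD ?(gt_eqF r0) ?implybT// powRr1 ?ltW//; ring.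
Qed.

(** Euler's formula for the Beta integral.  The Laplace transform at 1 of the
    convolution is [Gamma al * Gamma be]; by homogeneity it is also the value at
    1 of the convolution times [Gamma (al + be)].  Since the computation takes
    place in the extended reals, it gives the finiteness as well. *)
Lemma tricomi_convolution0_Gamma al be : 0 < al -> 0 < be ->
  (tricomi_convolution 0 al be 1 = (Gamma al * Gamma be / Gamma (al + be))%:E)%E.
Proof.
move=> al0 be0.
have ab0 : 0 < al + be by rewrite addr_gt0.
have mc := measurable_EFin_tricomi_density 0.
have c0 := EFin_tricomi_density_ge0 0.
have := laplace_convolution 1 (mc al) (mc be) (c0 al) (c0 be).
rewrite !laplace_tricomi_density// -!GammaE.
rewrite -/(tricomi_convolution 0 al be).
have -> : laplace (tricomi_convolution 0 al be) 1 =
    (tricomi_convolution 0 al be 1 * (Gamma (al + be))%:E)%E.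
  rewrite GammaE -laplace_tricomi_density//.
  have mL := measurable_laplace_integrand 1 (mc (al + be)).
  have L0 (t : R) : (0 <= (tricomi_density 0 (al + be) t)%:E * (expR (- (1 * t)))%:E)%E.
    by rewrite mule_ge0// lee_fin expR_ge0.
  have B0 : (0 <= tricomi_convolution 0 al be 1)%E by apply: convolution_ge0.
  have <- := @ge0_integralZl _ _ _ mu _ measurableT _ mL _ (fun t _ => L0 t) B0.
  rewrite /laplace.
  apply: eq_integral => t _.
  rewrite [RHS]muleA.
  congr (_ * _)%E.
  have [t0|t0] := ltP 0 t.
    by rewrite tricomi_convolution0_scale// tricomi_density0// muleC.
  rewrite (tricomi_density_le0 _ _ t0) mule0.
  apply: integral0_eq => s _.
  have [s0|s0] := ltP 0 s; last by rewrite tricomi_density_le0// mul0e.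
  rewrite (@tricomi_density_le0 _ _ be (t - s)) ?mule0//.
  by rewrite subr_le0 (le_trans t0)// ltW.
have := Gamma_gt0 ab0.
move: (Gamma (al + be)) (Gamma al) (Gamma be) (tricomi_convolution 0 al be 1).
move=> G G1 G2 B G0 /(congr1 (fun z => z * G^-1%:E)%E).
by rewrite -muleA -EFinM mulfV ?gt_eqF// mule1 => ->; rewrite EFinM EFinM.
Qed.

End laplace_density.

(** * Densities that cross once *)

Section crossing.
Context d (T : measurableType d) (R : realType) (nu : {measure set T -> \bar R}).

Lemma Rintegral_gt0 (D : set T) (f : T -> R) : measurable D -> (0 < nu D)%E ->
  nu.-integrable D (EFin \o f) -> {ae nu, forall t, D t -> 0 < f t} ->
  (forall t, D t -> 0 <= f t) -> 0 < \int[nu]_(t in D) f t.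
Proof.
move=> mD D0 fi fpos f0.
have fin : (\int[nu]_(t in D) (f t)%:E \is a fin_num)%E by exact: integrable_fin_num.
rewrite -lte_fin /Rintegral fineK//; apply: ge0_integral_gt0 => //.
exact: measurable_int fi.
Qed.

(** The quotient [f / g] increases with [w], so [f - g] is negative for [w < w0]
    and positive for [w > w0], for some threshold [w0].  Then
    [(f - g) (H w - H w0)] is nonnegative, and positive off the null set
    [w = w0]; as [f - g] has integral zero, the integral of this product is the
    difference of the two sides. *)
Lemma single_crossing (D : set T) (f g w : T -> R) (H : R -> R) (M : R) :
  measurable D -> (0 < nu D)%E ->
  nu.-integrable D (EFin \o f) -> nu.-integrable D (EFin \o g) ->
  nu.-integrable D (EFin \o (fun t => f t * H (w t))) ->
  nu.-integrable D (EFin \o (fun t => g t * H (w t))) ->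
  \int[nu]_(t in D) f t = \int[nu]_(t in D) g t ->
  (forall t, D t -> 0 < f t) -> (forall t, D t -> 0 < g t) ->
  (forall t, D t -> 0 < w t <= M) ->
  (forall s t, D s -> D t -> w s < w t -> f s * g t < f t * g s) ->
  (forall x y, 0 < x -> x < y -> H x < H y) ->
  (forall t, D t -> {ae nu, forall s, D s -> w s != w t}) ->
  \int[nu]_(t in D) (g t * H (w t)) < \int[nu]_(t in D) (f t * H (w t)).
Proof.
move=> mD D0 fi gi fHi gHi fg f0 g0 wM mlr Hinc level.
have fgi : nu.-integrable D (EFin \o (fun t => f t - g t)).
  have := integrableB mD fi gi; apply: eq_integrable => // t _.
(* f does not dominate g everywhere, the two having equal mass *)
have [s1 [Ds1 fgs1]] : exists s, D s /\ f s <= g s.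
  apply: contrapT => nex.
  have fg_lt t : D t -> g t < f t.
    by move=> Dt; rewrite ltNge; apply/negP => fgt; apply: nex; exists t.
  have : 0 < \int[nu]_(t in D) (f t - g t).
    apply: Rintegral_gt0 => //; first by apply: aeW => t Dt; rewrite subr_gt0 fg_lt.
    by move=> t Dt; rewrite subr_ge0 ltW// fg_lt.
  by rewrite RintegralB// fg subrr ltxx.
pose E := [set x | exists t, [/\ D t, f t <= g t & x = w t]].
(* the threshold is the last value of w at which f does not exceed g *)
have supE : has_sup E.
  split; first by exists (w s1), s1.
  by exists M => _ [t [Dt _ ->]]; have /andP[] := wM _ Dt.
pose w0 := sup E.
have gtw0 t : D t -> w0 < w t -> g t < f t.
  move=> Dt wt; rewrite ltNge; apply/negP => fgt.
  by move: wt; apply/negP; rewrite -leNgt; apply: sup_upper_bound => //; exists t.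
have ltw0 t : D t -> w t < w0 -> f t < g t.
  move=> Dt wt.
  have e0 : 0 < w0 - w t by rewrite subr_gt0.
  have [_ [s [Ds fgs ->]]] := sup_adherent e0 supE.
  rewrite -/w0 opprB addrC subrK => ws.
  have /= := mlr _ _ Dt Ds ws => h.
  rewrite -(ltr_pM2r (g0 _ Ds)); apply: (lt_le_trans h).
  by rewrite mulrC ler_pM2l ?g0.
have w00 : 0 < w0.
  have /andP[h _] := wM _ Ds1; apply: (lt_le_trans h).
  by apply: sup_upper_bound => //; exists s1.
pose phi t := (f t - g t) * (H (w t) - H w0).
have phi_gt0 t : D t -> w t != w0 -> 0 < phi t.
  move=> Dt; rewrite neq_lt => /orP[wt|wt]; rewrite /phi.
    rewrite nmulr_rgt0 ?subr_lt0 ?ltw0// Hinc//.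
    by have /andP[] := wM _ Dt.
  by rewrite mulr_gt0// subr_gt0 ?gtw0// Hinc.
have phi_ge0 t : D t -> 0 <= phi t.
  move=> Dt; have [wt|wt] := eqVneq (w t) w0; first by rewrite /phi wt subrr mulr0.
  exact/ltW/phi_gt0.
have ae_w0 : {ae nu, forall t, D t -> w t != w0}.
  have [[t [Dt wt]]|nex] := pselect (exists t, D t /\ w t = w0).
    by rewrite -wt; exact: level.
  by apply: aeW => t Dt; apply/eqP => wt; apply: nex; exists t.
have fgHi : nu.-integrable D (EFin \o (fun t => f t * H (w t) - g t * H (w t))).
  have := integrableB mD fHi gHi; apply: eq_integrable => // t _.
have cfgi : nu.-integrable D (EFin \o (fun t => H w0 * (f t - g t))).
  have := integrableZl mD (H w0) fgi; apply: eq_integrable => // t _.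
have phiE : phi = (fun t => (f t * H (w t) - g t * H (w t)) - H w0 * (f t - g t)).
  by apply/funext => t; rewrite /phi; ring.
have phii : nu.-integrable D (EFin \o phi).
  rewrite phiE; have := integrableB mD fgHi cfgi; apply: eq_integrable => // t _.
have : 0 < \int[nu]_(t in D) phi t.
  apply: Rintegral_gt0 => //; apply: filterS ae_w0 => t h Dt.
  by apply: phi_gt0 => //; exact: h.
rewrite phiE RintegralB// RintegralZl// RintegralB// RintegralB//.
by rewrite fg subrr mulr0 subr0 subr_gt0.
Qed.

End crossing.

Section cosh.
Variable R : realType.
Implicit Types x y : R.



(** For twice the hyperbolic cosine: with [X = exp |x|] and [Y = exp |y|] the
    difference is [(Y - X) (1 - 1 / (X Y))]. *)
Lemma dcosh_lt x y : `|x| < `|y| -> expR x + expR (- x) < expR y + expR (- y).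
Proof.
have dcosh_norm (z : R) : expR z + expR (- z) = expR `|z| + expR (- `|z|).
  by case: (ger0P z) => // _; rewrite opprK addrC.
rewrite (dcosh_norm x) (dcosh_norm y).
move: (normr_ge0 x) (normr_ge0 y).
move: `|x| `|y| => {}x {}y x0 y0 xy.
rewrite !expRN -subr_gt0.
have ex := expR_gt0 x; have ey := expR_gt0 y.
have -> : expR y + (expR y)^-1 - (expR x + (expR x)^-1) =
    (expR y - expR x) * (1 - (expR x * expR y)^-1).
  by field; rewrite !gt_eqF.
rewrite mulr_gt0// subr_gt0 ?ltr_expR// invf_lt1 ?mulr_gt0//.
rewrite -expRD -expR0 ltr_expR; lra.
Qed.

(** [cosh (d z) / cosh (d' z)] decreases with [|z|].  By the product formula
    [2 cosh u cosh v = cosh (u+v) + cosh (u-v)], the claim becomes two instances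
    of the monotonicity of cosh. *)
Lemma dcosh_ratio_lt (d d' x y : R) : 0 <= d -> d < d' -> `|y| < `|x| ->
  (expR (d * x) + expR (- (d * x))) * (expR (d' * y) + expR (- (d' * y))) <
  (expR (d * y) + expR (- (d * y))) * (expR (d' * x) + expR (- (d' * x))).
Proof.
move=> d0 dd' yx.
have prod (a b : R) : (expR a + expR (- a)) * (expR b + expR (- b)) =
    (expR (a + b) + expR (- (a + b))) + (expR (a - b) + expR (- (a - b))).
  rewrite mulrDl !mulrDr -!expRD.
  have -> : - (a + b) = - a - b by ring.
  have -> : - (a - b) = - a + b by ring.
  ring.
have even (a b : R) : expR (a * b) + expR (- (a * b)) = expR (a * `|b|) + expR (- (a * `|b|)).
  by case: (ger0P b) => // _; rewrite mulrN opprK addrC.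
rewrite (even d x) (even d' x) (even d y) (even d' y).
move: (normr_ge0 x) (normr_ge0 y) yx.
move: `|x| `|y| => {}x {}y x0 y0 yx.
rewrite !prod ltrD// dcosh_lt//.
  have h : 0 < (d' - d) * (x - y) by rewrite mulr_gt0// subr_gt0.
  have h1 : 0 <= d * x + d' * y by rewrite addr_ge0// mulr_ge0//; lra.
  by rewrite !ger0_norm//; nra.
have h1 : 0 < (d' - d) * (x + y) by rewrite mulr_gt0// ?subr_gt0//; lra.
have h2 : 0 < (d' + d) * (x - y) by rewrite mulr_gt0// ?subr_gt0//; lra.
rewrite (distrC (d * y)) (@gtr0_norm _ (d' * x - _)); last by nra.
by rewrite ltr_norml; apply/andP; split; nra.
Qed.

(** The Beta kernel symmetrized in [u <-> r - u]: only the symmetrized kernels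
    have a quotient that is a function of [u (r - u)]. *)
Definition sym_beta_kernel (a b r u : R) : R :=
  u `^ (a - 1) * (r - u) `^ (b - 1) + u `^ (b - 1) * (r - u) `^ (a - 1).

(** With [M = (ln u + ln (r-u)) / 2] and [L = (ln u - ln (r-u)) / 2], the kernel
    is [exp ((a+b-2) M)] times twice [cosh ((a-b) L)].  The first factors of both
    kernels coincide, and [|L|] decreases when [u (r-u)] increases because
    [2 cosh (2 L) = r^2 / (u (r-u)) - 2]. *)
Lemma sym_beta_kernel_ratio_lt (p1 p2 q1 q2 r s t : R) :
  p2 <= p1 -> p1 < q1 -> p1 + p2 = q1 + q2 ->
  0 < s < r -> 0 < t < r -> s * (r - s) < t * (r - t) ->
  sym_beta_kernel p1 p2 r s * sym_beta_kernel q1 q2 r t <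
  sym_beta_kernel p1 p2 r t * sym_beta_kernel q1 q2 r s.
Proof.
move=> p21 pq1 pq /andP[s0 sr] /andP[t0 tr] st.
pose L u : R := (ln u - ln (r - u)) / 2.
have LE (u : R) : 0 < u -> u < r ->
    expR (2 * L u) + expR (- (2 * L u)) = r ^+ 2 / (u * (r - u)) - 2.
  move=> u0 ur; have u1 : 0 < r - u by lra.
  have -> : 2 * L u = ln u - ln (r - u) by rewrite /L; field.
  rewrite opprB !expRD !expRN !lnK ?posrE//.
  by field; rewrite !gt_eqF.
have Lts : `|L t| < `|L s|.
  rewrite ltNge; apply/negP => hL.
  have : expR (2 * L s) + expR (- (2 * L s)) <= expR (2 * L t) + expR (- (2 * L t)).
    move: hL; rewrite le_eqVlt => /orP[/eqP hL|hL]; last first.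
      by apply/ltW/dcosh_lt; rewrite [ltLHS]normrM [ltRHS]normrM ltr_pM2l// normr_gt0.
    move/eqP: hL; rewrite eqr_norm2 => /orP[/eqP->|/eqP->]; first exact: lexx.
    by rewrite mulrN opprK addrC.
  have sp : 0 < s * (r - s) by rewrite mulr_gt0// subr_gt0.
  have tp : 0 < t * (r - t) by rewrite mulr_gt0// subr_gt0.
  rewrite !LE// lerD2r ler_pM2l ?exprn_gt0//; last by lra.
  by rewrite lef_pV2 ?posrE// leNgt st.
have KE (a b u : R) : 0 < u -> u < r -> sym_beta_kernel a b r u =
    expR ((a + b - 2) * ((ln u + ln (r - u)) / 2)) *
    (expR ((a - b) * L u) + expR (- ((a - b) * L u))).
  move=> u0 ur; have u1 : 0 < r - u by lra.
  rewrite /sym_beta_kernel /powR !gt_eqF// mulrDr -!expRD.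
  by congr (expR _ + expR _); rewrite /L; field.
rewrite !KE// pq.
set G := fun u => expR ((q1 + q2 - 2) * ((ln u + ln (r - u)) / 2)).
rewrite -/(G s) -/(G t).
have Gp : 0 < G s * G t by rewrite mulr_gt0// expR_gt0.
rewrite mulrACA [ltRHS]mulrACA (mulrC (G t)) ltr_pM2l//.
apply: dcosh_ratio_lt => //; lra.
Qed.

End cosh.

(** * Comparison of the convolutions of two pairs *)

Local Opaque Gamma.

Section pair.
Variable R : realType.

Definition conv_integrand (c a b r s : R) : R :=
  tricomi_density c a s * tricomi_density c b (r - s).

Lemma conv_integrand_ge0 c a b r s : 0 <= conv_integrand c a b r s.
Proof. by rewrite mulr_ge0 ?tricomi_density_ge0. Qed.

Lemma measurable_conv_integrand c a b r :
  measurable_fun setT (fun s => (conv_integrand c a b r s)%:E).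
Proof.
apply/measurable_EFinP; apply: measurable_funM; first exact: measurable_tricomi_density.
apply: (measurableT_comp (measurable_tricomi_density c b)).
exact: measurable_funB.
Qed.

Lemma conv_integrand_out c a b r s : ~~ (0 < s < r) -> conv_integrand c a b r s = 0.
Proof.
rewrite negb_and -!leNgt => /orP[h|h].
  by rewrite /conv_integrand tricomi_density_le0// mul0r.
by rewrite /conv_integrand (@tricomi_density_le0 _ _ b) ?mulr0// subr_le0.
Qed.

Lemma tricomi_convolution_itv (c a b r : R) :
  (tricomi_convolution c a b r = \int[mu]_(s in `]0%R, r[) (conv_integrand c a b r s)%:E)%E.
Proof.
rewrite [RHS]integral_mkcond; apply: eq_integral => s _.
rewrite patchE; case: ifPn => // hs; rewrite -EFinM -/(conv_integrand c a b r s).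
rewrite conv_integrand_out//; apply: contra hs => hs.
by rewrite inE/= in_itv.
Qed.

Lemma tricomi_convolution_ge0 (c a b r : R) : (0 <= tricomi_convolution c a b r)%E.
Proof. by apply: integral_ge0 => s _; rewrite -EFinM lee_fin conv_integrand_ge0. Qed.

Lemma conv_integrand_le c a b r s : 0 < r ->
  conv_integrand c a b r s <= ((1 + r) * (1 + r)) `^ `|c| * conv_integrand 0 a b r s.
Proof.
move=> r0; have [/andP[s0 sr]|hs] := boolP (0 < s < r); last first.
  by rewrite !conv_integrand_out// mulr0.
have rs0 : 0 < r - s by lra.
rewrite /conv_integrand /tricomi_density s0 rs0 !powRr0 !mulr1.
rewrite mulrACA mulrC ler_pM2r ?mulr_gt0 ?powR_gt0//.
rewrite -powRM; [|lra|lra].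
apply: (@le_trans _ _ (((1 + s) * (1 + (r - s))) `^ `|c|)).
  by rewrite ler_powR ?ler_norm//; nra.
by apply: ge0_ler_powR => //; rewrite ?nnegrE; nra.
Qed.

Lemma tricomi_convolution_lty (c a b r : R) : 0 < a -> 0 < b -> 0 < r ->
  (tricomi_convolution c a b r < +oo)%E.
Proof.
move=> a0 b0 r0.
pose C := ((1 + r) * (1 + r)) `^ `|c|.
have C0 : (0 <= C%:E)%E by rewrite lee_fin powR_ge0.
have m d := measurable_conv_integrand d a b r.
have k0 d s : (0 <= (conv_integrand d a b r s)%:E)%E by rewrite lee_fin conv_integrand_ge0.
have -> : (tricomi_convolution c a b r = \int[mu]_s (conv_integrand c a b r s)%:E)%E by [].
apply: (@le_lt_trans _ _ (\int[mu]_s (C%:E * (conv_integrand 0 a b r s)%:E))%E).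
  apply: ge0_le_integral => //.
  - exact: (m c).
  - by apply: emeasurable_funM => //; exact: (m 0).
  - by move=> s _; rewrite -!EFinM lee_fin; exact: conv_integrand_le.
have -> := @ge0_integralZl _ _ _ mu _ measurableT _ (m 0) _ (fun s _ => k0 0 s) C0.
have -> : (\int[mu]_s (conv_integrand 0 a b r s)%:E = tricomi_convolution 0 a b r)%E by [].
by rewrite tricomi_convolution0_scale// tricomi_convolution0_Gamma// -!EFinM ltry.
Qed.

(** What remains of the integrand, as a function of [w = s (r - s)], when the
    exponents of the Beta kernel are raised by [e]. *)
Definition modulation (e c r w : R) : R := w `^ (- e) * (1 + r + w) `^ c.

Lemma conv_integrand_sym (e c a b r s : R) : 0 < s < r ->
  conv_integrand c a b r s + conv_integrand c b a r s =
  sym_beta_kernel (a + e) (b + e) r s * modulation e c r (s * (r - s)).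
Proof.
move=> /andP[s0 sr]; have rs0 : 0 < r - s by lra.
rewrite /conv_integrand /tricomi_density s0 rs0 /sym_beta_kernel /modulation.
have -> : 1 + r + s * (r - s) = (1 + s) * (1 + (r - s)) by ring.
rewrite !powRM ?(ltW s0) ?(ltW rs0)//; [|lra|lra].
have shift (x u : R) : 0 < u -> u `^ (x + e - 1) * u `^ (- e) = u `^ (x - 1).
  move=> u0; rewrite -powRD ?(gt_eqF u0) ?implybT//; congr (_ `^ _); ring.
rewrite -(shift a s)// -(shift b s)// -(shift a (r - s))// -(shift b (r - s))//.
ring.
Qed.

Lemma integrable_conv_integrand c a b r : 0 < a -> 0 < b -> 0 < r ->
  mu.-integrable `]0, r[ (fun s => (conv_integrand c a b r s)%:E).
Proof.
move=> a0 b0 r0; apply/integrableP; split.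
  by apply: measurable_funTS; exact: measurable_conv_integrand.
rewrite (le_lt_trans _ (tricomi_convolution_lty c a0 b0 r0))//.
rewrite tricomi_convolution_itv le_eqVlt; apply/orP; left; apply/eqP.
by apply: eq_integral => s _; rewrite gee0_abs// lee_fin conv_integrand_ge0.
Qed.

Definition sym_convolution (c a b r : R) : \bar R :=
  (tricomi_convolution c a b r + tricomi_convolution c b a r)%E.

Lemma integrable_sym_kernel (e c a b r : R) : 0 < a -> 0 < b -> 0 < r ->
  mu.-integrable `]0, r[ (EFin \o (fun s =>
    sym_beta_kernel (a + e) (b + e) r s * modulation e c r (s * (r - s)))).
Proof.
move=> a0 b0 r0.
have mD : measurable (`]0, r[%classic : set (measurableTypeR R)) by exact: measurable_itv.
have := integrableD mD (integrable_conv_integrand c a0 b0 r0)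
  (integrable_conv_integrand c b0 a0 r0).
apply: eq_integrable => // s; rewrite inE/= in_itv/= => hs.
by rewrite -conv_integrand_sym.
Qed.

Lemma sym_convolutionE (e c a b r : R) : 0 < a -> 0 < b -> 0 < r ->
  sym_convolution c a b r = (\int[mu]_(s in `]0, r[)
    (sym_beta_kernel (a + e) (b + e) r s * modulation e c r (s * (r - s))))%:E.
Proof.
move=> a0 b0 r0.
have mD : measurable (`]0, r[%classic : set (measurableTypeR R)) by exact: measurable_itv.
rewrite /sym_convolution !tricomi_convolution_itv.
rewrite -integralD//; [|exact: integrable_conv_integrand..].
rewrite /Rintegral fineK; last first.
  exact: integrable_fin_num (integrable_sym_kernel e c a0 b0 r0).
apply: eq_integral => s; rewrite inE/= in_itv/= => hs.
by rewrite -conv_integrand_sym.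
Qed.

(** Divided by [Gamma a * Gamma b], the mass depends on [a] and [b] only through
    their sum. *)
Lemma Rintegral_sym_beta_kernel (a b r : R) : 0 < a -> 0 < b -> 0 < r ->
  \int[mu]_(s in `]0, r[) sym_beta_kernel a b r s =
  2 * r `^ (a + b - 1) / Gamma (a + b) * (Gamma a * Gamma b).
Proof.
move=> a0 b0 r0.
apply: EFin_inj.
transitivity (sym_convolution 0 a b r).
  rewrite (sym_convolutionE 0 0 a0 b0 r0); congr EFin; apply: eq_Rintegral => s _.
  by rewrite /modulation oppr0 !powRr0 !mulr1 !addr0.
rewrite /sym_convolution.
rewrite !(tricomi_convolution0_scale _ _ r0) !tricomi_convolution0_Gamma//.
rewrite -!EFinM -EFinD (addrC b a); congr EFin.
have := Gamma_gt0 (addr_gt0 a0 b0).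
move: (Gamma (a + b)) (Gamma a) (Gamma b) (r `^ _) => G Ga Gb P G0.
by field; rewrite gt_eqF.
Qed.

Lemma integrable_sym_beta_kernel (a b r : R) : 0 < a -> 0 < b -> 0 < r ->
  mu.-integrable `]0, r[ (EFin \o sym_beta_kernel a b r).
Proof.
move=> a0 b0 r0.
have mD : measurable (`]0, r[%classic : set (measurableTypeR R)) by exact: measurable_itv.
have := integrable_sym_kernel 0 0 a0 b0 r0.
apply: eq_integrable => // s _ /=.
by rewrite /modulation oppr0 !powRr0 !mulr1 !addr0.
Qed.

Lemma ae_neq_parabola (r t : R) (D : set R) :
  {ae mu, forall s, D s -> s * (r - s) != t * (r - t)}.
Proof.
exists ([set t] `|` [set r - t]); split.
- exact: measurableU.
- by apply: null_set_setU => //; exact: lebesgue_measure_set1.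
- move=> s /= /not_implyP[_ /negP]; rewrite negbK => /eqP h.
  have : (s - t) * (r - s - t) = 0.
    have -> : (s - t) * (r - s - t) = s * (r - s) - t * (r - t) by ring.
    by rewrite h subrr.
  move/eqP; rewrite mulf_eq0 => /orP[|] /eqP h'; [left|right]; lra.
Qed.

Lemma sym_beta_kernel_gt0 (a b r s : R) : `]0, r[%classic s -> 0 < sym_beta_kernel a b r s.
Proof.
rewrite /= in_itv/= => /andP[s0 sr].
by rewrite addr_gt0// mulr_gt0// powR_gt0// subr_gt0.
Qed.

Local Opaque sym_convolution sym_beta_kernel modulation.

Lemma parabola_bounds (r s : R) : `]0, r[%classic s -> 0 < s * (r - s) <= r * r.
Proof.
rewrite /= in_itv/= => /andP[s0 sr].
by rewrite mulr_gt0 ?subr_gt0//=; nra.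
Qed.

(** The two Beta kernels are normalized to a common mass, and [single_crossing]
    applies to them with [sg] times the modulation as the increasing function. *)
Lemma sym_convolution_lt_aux (sg e c p1 p2 q1 q2 P1 P2 Q1 Q2 r : R) :
  (forall x y, 0 < x -> x < y -> sg * modulation e c r x < sg * modulation e c r y) ->
  P1 = p1 + e -> P2 = p2 + e -> Q1 = q1 + e -> Q2 = q2 + e ->
  P2 <= P1 -> P1 < Q1 -> P1 + P2 = Q1 + Q2 ->
  0 < p1 -> 0 < p2 -> 0 < q1 -> 0 < q2 ->
  0 < P1 -> 0 < P2 -> 0 < Q1 -> 0 < Q2 -> 0 < r ->
  sg * (fine (sym_convolution c q1 q2 r) / (Gamma Q1 * Gamma Q2)) <
  sg * (fine (sym_convolution c p1 p2 r) / (Gamma P1 * Gamma P2)).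
Proof.
move=> Hinc P1E P2E Q1E Q2E P21 PQ1 PQ p10 p20 q10 q20 P10 P20 Q10 Q20 r0.
have mD : measurable (`]0, r[%classic : set (measurableTypeR R)) by exact: measurable_itv.
have pi := integrable_sym_kernel e c p10 p20 r0.
have qi := integrable_sym_kernel e c q10 q20 r0.
have pE := sym_convolutionE e c p10 p20 r0.
have qE := sym_convolutionE e c q10 q20 r0.
rewrite -P1E -P2E in pi pE; rewrite -Q1E -Q2E in qi qE.
have bpi := integrable_sym_beta_kernel P10 P20 r0.
have bqi := integrable_sym_beta_kernel Q10 Q20 r0.
have bpE := Rintegral_sym_beta_kernel P10 P20 r0.
have bqE := Rintegral_sym_beta_kernel Q10 Q20 r0.
have Np0 : 0 < Gamma P1 * Gamma P2 by rewrite mulr_gt0 ?Gamma_gt0.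
have Nq0 : 0 < Gamma Q1 * Gamma Q2 by rewrite mulr_gt0 ?Gamma_gt0.
rewrite pE qE {pE qE}/=.
move: (Gamma P1 * _) (Gamma Q1 * _) Np0 Nq0 bpE bqE => Np Nq Np0 Nq0 bpE bqE.
pose w s := s * (r - s).
pose f s := Np^-1 * sym_beta_kernel P1 P2 r s.
pose g s := Nq^-1 * sym_beta_kernel Q1 Q2 r s.
have fi : mu.-integrable `]0, r[ (EFin \o f).
  by have := integrableZl mD Np^-1 bpi; apply: eq_integrable => // s _.
have gi : mu.-integrable `]0, r[ (EFin \o g).
  by have := integrableZl mD Nq^-1 bqi; apply: eq_integrable => // s _.
have fHi : mu.-integrable `]0, r[ (EFin \o (fun s => f s * (sg * modulation e c r (w s)))).
  have := integrableZl mD (sg / Np) pi.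
  apply: eq_integrable => // s _ /=; rewrite -EFinM; congr EFin.
  by rewrite /f /w; ring.
have gHi : mu.-integrable `]0, r[ (EFin \o (fun s => g s * (sg * modulation e c r (w s)))).
  have := integrableZl mD (sg / Nq) qi.
  apply: eq_integrable => // s _ /=; rewrite -EFinM; congr EFin.
  by rewrite /g /w; ring.
have fE : \int[mu]_(s in `]0, r[) (f s * (sg * modulation e c r (w s))) =
    (sg / Np) * \int[mu]_(s in `]0, r[)
      (sym_beta_kernel P1 P2 r s * modulation e c r (s * (r - s))).
  rewrite -[RHS](@RintegralZl _ _ _ mu _ _ (sg / Np) mD pi).
  by apply: eq_Rintegral => s _; rewrite /f /w; ring.
have gE : \int[mu]_(s in `]0, r[) (g s * (sg * modulation e c r (w s))) =
    (sg / Nq) * \int[mu]_(s in `]0, r[)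
      (sym_beta_kernel Q1 Q2 r s * modulation e c r (s * (r - s))).
  rewrite -[RHS](@RintegralZl _ _ _ mu _ _ (sg / Nq) mD qi).
  by apply: eq_Rintegral => s _; rewrite /g /w; ring.
have muD : (0 < mu (`]0%R, r[%classic : set R))%E.
  by rewrite lebesgue_measure_itv/= lte_fin r0 sube0 lte_fin.
have fg : \int[mu]_(s in `]0, r[) f s = \int[mu]_(s in `]0, r[) g s.
  have -> := @RintegralZl _ _ _ mu _ _ Np^-1 mD bpi.
  have -> := @RintegralZl _ _ _ mu _ _ Nq^-1 mD bqi.
  rewrite bpE bqE PQ; move: (2 * _ / _) => z.
  by rewrite [LHS]mulrC [RHS]mulrC !mulfK ?gt_eqF.
have f0 (s : R) : `]0, r[%classic s -> 0 < f s.
  by move=> Ds; apply: mulr_gt0; [rewrite invr_gt0|exact: sym_beta_kernel_gt0].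
have g0 (s : R) : `]0, r[%classic s -> 0 < g s.
  by move=> Ds; apply: mulr_gt0; [rewrite invr_gt0|exact: sym_beta_kernel_gt0].
have mlr (s t : R) : `]0, r[%classic s -> `]0, r[%classic t -> w s < w t ->
    f s * g t < f t * g s.
  rewrite /= !in_itv/= => Ds Dt st.
  rewrite /f /g mulrACA [ltRHS]mulrACA ltr_pM2l; last by rewrite mulr_gt0 ?invr_gt0.
  exact: sym_beta_kernel_ratio_lt.
have := @single_crossing _ _ _ mu _ f g w _ (r * r) mD muD fi gi fHi gHi fg
  f0 g0 (@parabola_bounds r) mlr Hinc (fun t _ => ae_neq_parabola r t _).
rewrite fE gE; move: (\int[mu]_(s in _) _) => x; move: (\int[mu]_(s in _) _) => y.
have swap (u N : R) : sg / N * u = sg * (u / N) by rewrite mulrAC -mulrA.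
by rewrite !swap.
Qed.

Lemma sym_convolution_lt (sg e c p1 p2 q1 q2 r : R) :
  (forall x y, 0 < x -> x < y -> sg * modulation e c r x < sg * modulation e c r y) ->
  p2 <= p1 -> p1 < q1 -> p1 + p2 = q1 + q2 ->
  0 < p2 -> 0 < q2 -> 0 < p2 + e -> 0 < q2 + e -> 0 < r ->
  sg * (fine (sym_convolution c q1 q2 r) / (Gamma (q1 + e) * Gamma (q2 + e))) <
  sg * (fine (sym_convolution c p1 p2 r) / (Gamma (p1 + e) * Gamma (p2 + e))).
Proof.
by move=> *; apply: (@sym_convolution_lt_aux _ e) => //; lra.
Qed.

Local Transparent modulation.

(** For [e = 0] the modulation is the power [c] of an increasing function; for
    [e = c] it is the power [c] of the decreasing function [1 + (1+r)/w].  The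
    sign [sg] turns a decreasing modulation into an increasing one. *)
Lemma modulation_inc (sg e c r x y : R) : (e = 0 /\ 0 < sg * c) \/ (e = c /\ sg * c < 0) ->
  `|sg| = 1 -> 0 < r -> 0 < x -> x < y ->
  sg * modulation e c r x < sg * modulation e c r y.
Proof.
move=> ec sg1 r0 x0 xy.
have y0 : 0 < y by lra.
have lnlt (c' u v : R) : 0 < u -> u < v -> 0 < c' -> u `^ c' < v `^ c'.
  by move=> u0 uv c0; apply: gt0_ltr_powR; rewrite ?nnegrE//; lra.
have lngt (c' u v : R) : 0 < u -> u < v -> c' < 0 -> v `^ c' < u `^ c'.
  move=> u0 uv c0; have E z : z `^ c' = (z `^ (- c'))^-1 by rewrite powRN invrK.
  have v0 : 0 < v by lra.
  rewrite !E ltf_pV2 ?posrE ?powR_gt0//.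
  by apply: lnlt => //; lra.
have : sg = 1 \/ sg = -1.
  by move: sg1; case: (ger0P sg) => _ h; [left|right]; lra.
case: ec => -[-> sc].
  rewrite /modulation oppr0 !powRr0 !mul1r => -[] sE; move: sc; rewrite sE.
    by rewrite !mul1r => c0; apply: lnlt => //; lra.
  by rewrite !mulN1r => c0; rewrite ltrN2; apply: lngt; lra.
have mE z : 0 < z -> modulation c c r z = (1 + (1 + r) / z) `^ c.
  move=> z0; rewrite /modulation powRN mulrC.
  have -> : 1 + r + z = z * (1 + (1 + r) / z) by field; rewrite gt_eqF.
  have q0 : 0 <= 1 + (1 + r) / z by rewrite addr_ge0// divr_ge0//; lra.
  by rewrite powRM ?(ltW z0)// mulrC mulKf// gt_eqF ?powR_gt0.
rewrite !mE//.
have lt : 1 + (1 + r) / y < 1 + (1 + r) / x.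
  by rewrite ltrD2l ltr_pM2l ?ltf_pV2 ?posrE//; lra.
have y1 : 0 < 1 + (1 + r) / y by rewrite addr_gt0// divr_gt0//; lra.
case=> sE; move: sc; rewrite sE.
  by rewrite !mul1r => c0; apply: lngt => //; lra.
by rewrite !mulN1r => c0; rewrite ltrN2; apply: lnlt; lra.
Qed.

End pair.

(** * Laplace transforms of nonnegative densities *)

Section laplace_transforms.
Variable R : realType.
Implicit Types F G : R -> R.

(** Positivity of the values is part of the notion: it yields the strict
    inequalities, and it is inherited by sums and products. *)
Definition positive_laplace_transform F : Prop :=
  exists f : R -> \bar R, [/\ measurable_fun setT f,
    forall t, (0 <= f t)%E, forall t, t <= 0 -> f t = 0%E,
    forall x, 0 < x -> laplace f x = (F x)%:E &
    forall x, 0 < x -> 0 < F x].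

Lemma eq_positive_laplace_transform F G : (forall x, 0 < x -> F x = G x) ->
  positive_laplace_transform F -> positive_laplace_transform G.
Proof.
by move=> FG [f [mf f0 fN fF F0]]; exists f; split => // x x0; rewrite -FG// ?fF ?F0.
Qed.

Lemma positive_laplace_transformM F G : positive_laplace_transform F ->
  positive_laplace_transform G -> positive_laplace_transform (fun x => F x * G x).
Proof.
move=> [f [mf f0 fN fF F0]] [g [mg g0 gN gG G0]].
exists (convolution f g); split.
- exact: measurable_convolution.
- by move=> t; exact: convolution_ge0.
- move=> t t0; apply: integral0_eq => s _.
  have [s0|s0] := ltP 0 s; last by rewrite fN// mul0e.
  by rewrite (gN (t - s)) ?mule0// subr_le0 (le_trans t0)// ltW.
- by move=> x x0; rewrite laplace_convolution// fF// gG.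
- by move=> x x0; rewrite mulr_gt0 ?F0 ?G0.
Qed.

Lemma positive_laplace_transformD F G : positive_laplace_transform F ->
  positive_laplace_transform G -> positive_laplace_transform (fun x => F x + G x).
Proof.
move=> [f [mf f0 fN fF F0]] [g [mg g0 gN gG G0]].
exists (fun t => f t + g t)%E; split.
- exact: emeasurable_funD.
- by move=> t; rewrite adde_ge0.
- by move=> t t0; rewrite fN// gN// adde0.
- move=> x x0; rewrite EFinD -fF// -gG// /laplace.
  have E0 (h : R -> \bar R) (t : R) : (forall t, 0 <= h t)%E ->
      (0 <= h t * (expR (- (x * t)))%:E)%E.
    by move=> h0; rewrite mule_ge0// lee_fin expR_ge0.
  have <- := @ge0_integralD _ _ _ mu _ measurableT _ _ (fun t _ => E0 f t f0)
    (measurable_laplace_integrand x mf) (fun t _ => E0 g t g0)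
    (measurable_laplace_integrand x mg).
  by apply: eq_integral => t _; rewrite ge0_muleDl.
- by move=> x x0; rewrite addr_gt0 ?F0 ?G0.
Qed.

Lemma positive_laplace_transformZ (k : R) F : 0 < k ->
  positive_laplace_transform F -> positive_laplace_transform (fun x => k * F x).
Proof.
move=> k0 [f [mf f0 fN fF F0]].
have k0' : (0 <= k%:E)%E by rewrite lee_fin ltW.
exists (fun t => k%:E * f t)%E; split.
- exact: emeasurable_funM.
- by move=> t; rewrite mule_ge0.
- by move=> t t0; rewrite fN// mule0.
- move=> x x0; rewrite EFinM -fF// /laplace.
  have E0 (t : R) : (0 <= f t * (expR (- (x * t)))%:E)%E.
    by rewrite mule_ge0// lee_fin expR_ge0.
  have <- := @ge0_integralZl _ _ _ mu _ measurableT _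
    (measurable_laplace_integrand x mf) _ (fun t _ => E0 t) k0'.
  by apply: eq_integral => t _; rewrite muleA.
- by move=> x x0; rewrite mulr_gt0 ?F0.
Qed.

Lemma positive_laplace_transform_tricomi (c al : R) : 0 < al ->
  positive_laplace_transform (tricomi_laplace c al).
Proof.
move=> al0; exists (fun t => (tricomi_density c al t)%:E); split.
- exact: measurable_EFin_tricomi_density.
- exact: EFin_tricomi_density_ge0.
- by move=> t t0; rewrite tricomi_density_le0.
- by move=> x x0; rewrite laplace_tricomi_density.
- by move=> x x0; rewrite tricomi_laplace_gt0.
Qed.

Section complete_monotonicity.
Variable g : R -> R.
Hypothesis mg : measurable_fun setT g.
Hypothesis g0 : forall t, 0 <= g t.
Hypothesis gN : forall t : R, t <= 0 -> g t = 0.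
Hypothesis gfin : forall x : R, 0 < x -> (laplace (EFin \o g) x < +oo)%E.

(* up to sign, the integrand of the m-th derivative *)
Let moment (m : nat) (x t : R) : R := g t * (t ^+ m * expR (- (x * t))).

Let measurable_moment m x : measurable_fun setT (moment m x).
Proof.
apply: measurable_funM => //; apply: measurable_funM.
  exact: measurable_funX.
by have /measurable_EFinP := measurable_expR_lin x.
Qed.

Let moment_ge0 m x t : 0 <= moment m x t.
Proof.
have [t0|t0] := ltP 0 t; last by rewrite /moment gN// mul0r.
by rewrite !mulr_ge0// ?exprn_ge0 ?expR_ge0// ltW.
Qed.

Let integrable_moment m (x : R) : 0 < x -> mu.-integrable setT (EFin \o moment m x).
Proof.
move=> x0; have x20 : 0 < x / 2 by rewrite divr_gt0.
have [C C0 hC] := powR_le_expR m%:R x20.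
have gi : mu.-integrable setT (fun t => (g t)%:E * (expR (- ((x / 2) * t)))%:E)%E.
  apply/integrableP; split.
    by apply: measurable_laplace_integrand; apply/measurable_EFinP.
  rewrite (le_lt_trans _ (gfin x20))// le_eqVlt; apply/orP; left; apply/eqP.
  by apply: eq_integral => t _; rewrite gee0_abs ?mule_ge0 ?lee_fin ?expR_ge0.
have := integrableZl measurableT C gi.
apply: le_integrable => //; first by apply/measurable_EFinP; exact: measurable_moment.
have C0' := ltW C0.
move=> t _ /=; rewrite lee_fin (ger0_norm (moment_ge0 m x t)) ger0_norm; last first.
  by rewrite !mulr_ge0 ?expR_ge0.
rewrite /moment; have [t0|t0] := ltP 0 t; last by rewrite gN// !mul0r mulr0.
rewrite [leRHS]mulrCA; apply: ler_wpM2l => //.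
have -> : - (x * t) = - (x / 2 * t) - (x / 2 * t) by field.
rewrite expRD mulrA; apply: ler_wpM2r; first exact: expR_ge0.
rewrite expRN ler_pdivrMr ?expR_gt0//.
apply: le_trans (hC t (ltW t0)); rewrite powR_mulrn; last by lra.
by rewrite lerXn2r ?nnegrE//; lra.
Qed.

Let is_derive_moment m (x t : R) : is_derive x 1 (fun y => moment m y t) (- moment m.+1 x t).
Proof.
have d1 : is_derive x 1 (fun y : R => - (y * t)) (- t).
  have := is_deriveN (is_deriveM (is_derive_id x 1) (is_derive_cst t x 1)).
  move=> h; apply: (is_derive_eq h).
  by rewrite scaler0 add0r /GRing.scale/= mulr1.
have d2 : is_derive x 1 (fun y : R => expR (- (y * t))) (expR (- (x * t)) * - t).
  exact: (@is_derive1_comp _ expR (fun y => - (y * t)) x _ _ (is_derive_expR _) d1).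
have d3 := is_deriveZ (g t * t ^+ m) d2.
have -> : (fun y => moment m y t) = (g t * t ^+ m) \*: (fun y : R => expR (- (y * t))).
  by apply/funext => y; rewrite /moment /= /GRing.scale/= mulrA.
apply: (is_derive_eq d3).
by rewrite /moment /GRing.scale/= exprS; ring.
Qed.

Let M m x : R := \int[mu]_t moment m x t.

(** Differentiation under the integral sign: on [(x/2, x+1)] the derivative of
    the integrand is dominated by the next moment at [x/2]. *)
Let derivative_M m (x : R) : 0 < x -> derivable (M m) x 1 /\ derive1 (M m) x = - M m.+1 x.
Proof.
move=> x0.
pose u := x / 2; pose v := x + 1.
have u0 : 0 < u by rewrite divr_gt0.
have Ia : `]u, v[%classic x by rewrite /= in_itv/= /u /v; apply/andP; split; lra.
have Ipos y : `]u, v[%classic y -> u < y by rewrite /= in_itv/= => /andP[].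
have intf y : `]u, v[%classic y -> mu.-integrable setT (EFin \o moment m y).
  by move=> /Ipos uy; apply: integrable_moment; exact: lt_trans uy.
have derf y t : `]u, v[%classic y -> setT t -> derivable (fun z => moment m z t) y 1.
  by move=> _ _; have [] := is_derive_moment m y t.
have dE y t : partial1of2 (moment m) y t = - moment m.+1 y t.
  by rewrite partial1of2E; have [_ ->] := is_derive_moment m y t.
have ub y t : `]u, v[%classic y -> setT t ->
    `|partial1of2 (moment m) y t| <= moment m.+1 u t.
  move=> /Ipos uy _; rewrite dE normrN ger0_norm//.
  have [t0|t0] := ltP 0 t; last by rewrite /moment gN// !mul0r.
  rewrite /moment ler_wpM2l// ler_wpM2l ?exprn_ge0 ?(ltW t0)//.
  by rewrite ler_expR lerN2 ler_pM2r// ltW.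
have iu := integrable_moment m.+1 u0.
split; first exact: (derivable_under_integral measurableT Ia intf derf
  (moment_ge0 m.+1 u) iu ub).
have -> := differentiation_under_integral measurableT Ia intf derf
  (moment_ge0 m.+1 u) iu ub.
transitivity (\int[mu]_t ((-1) * moment m.+1 x t)).
  by apply: eq_Rintegral => t _; rewrite dE mulN1r.
by rewrite (RintegralZl _ measurableT (integrable_moment m.+1 x0)) mulN1r.
Qed.

(** Each differentiation brings down a factor [- t], so the [m]-th derivative is
    [(-1)^m] times the integral of a nonnegative function. *)
Lemma laplace_completely_monotonic F :
  (forall x, 0 < x -> laplace (EFin \o g) x = (F x)%:E) ->
  completely_monotonic_on `]0, +oo[ F.
Proof.
move=> gF.
have FM (x : R) : 0 < x -> F x = M 0 x.
  move=> x0; apply: EFin_inj; rewrite -gF// /M /Rintegral fineK; last first.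
    exact: integrable_fin_num (integrable_moment 0 x0).
  by apply: eq_integral => t _; rewrite /moment expr0 mul1r.
have near_pos (x : R) : 0 < x -> \forall y \near x, 0 < y by move=> x0; exact: lt_nbhsr.
have key m : forall x : R, 0 < x -> derive1n m F x = (-1) ^+ m * M m x.
  elim: m => [|m IH] x x0; first by rewrite derive1n0 expr0 mul1r FM.
  have [dM M'] := derivative_M m x0.
  rewrite derive1nS derive1E.
  rewrite (@near_eq_derive _ _ _ _ ((-1) ^+ m \*: M m)); last first.
    by near=> y; rewrite /= IH//; near: y; exact: near_pos.
  rewrite deriveZ// -derive1E M' /GRing.scale/= exprS; ring.
move=> m x; rewrite /= in_itv/= andbT => x0; split.
  have [dM M'] := derivative_M m x0.
  apply: (@near_eq_derivable _ _ _ ((-1) ^+ m \*: M m)).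
    by near=> y; rewrite /= key//; near: y; exact: near_pos.
  exact: derivableZ.
rewrite key// mulrA -exprD addnn -mul2n exprM sqrrN !expr1n mul1r.
by apply: Rintegral_ge0 => t _.
Unshelve. all: by end_near. Qed.

End complete_monotonicity.

(** A density with values in the extended reals is finite almost everywhere,
    since its Laplace transform is finite; it can be replaced by a real one. *)
Lemma positive_laplace_transform_cm F : positive_laplace_transform F ->
  completely_monotonic_on `]0, +oo[ F.
Proof.
move=> [f [mf f0 fN fF F0]].
have ae_fin : {ae mu, forall t, setT t -> f t \is a fin_num}.
  have fi : mu.-integrable setT (fun t => f t * (expR (- (1 * t)))%:E)%E.
    apply/integrableP; split; first exact: measurable_laplace_integrand.
    rewrite (@le_lt_trans _ _ (laplace f 1))//; last by rewrite fF ?ltr01// ltry.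
    rewrite le_eqVlt; apply/orP; left; apply/eqP.
    by apply: eq_integral => t _; rewrite gee0_abs// mule_ge0// lee_fin expR_ge0.
  have := integrable_ae measurableT fi.
  apply: filterS => t h _; move: (h Logic.I).
  have := f0 t; case: (f t) => [r||] //= _.
  by rewrite gt0_mulye// lte_fin expR_gt0.
have mfine : measurable_fun setT (fine \o f) by exact: measurableT_comp.
have fineL (x : R) : 0 < x -> laplace (EFin \o (fine \o f)) x = (F x)%:E.
  move=> x0; rewrite -fF//; apply: ge0_ae_eq_integral => //.
  - by apply: measurable_laplace_integrand; apply/measurable_EFinP.
  - exact: measurable_laplace_integrand.
  - by move=> t _; rewrite mule_ge0 ?lee_fin ?expR_ge0 ?fine_ge0.
  - by move=> t _; rewrite mule_ge0 ?lee_fin ?expR_ge0.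
  - have [N [mN N0 sub]] := ae_fin; exists N; split => // t h; apply: sub => h'.
    by apply: h => _; rewrite /= fineK// h'.
apply: (@laplace_completely_monotonic (fine \o f)) => //.
- by move=> t; exact: fine_ge0.
- by move=> t t0; rewrite /= fN.
- by move=> x x0; rewrite fineL// ltry.
Qed.

End laplace_transforms.

(** * Products of two Tricomi functions *)

Local Opaque tricomi_laplace tricomi_convolution.

Section pair_laplace.
Variable R : realType.

Lemma integrable_laplace (g : R -> R) (x A : R) : measurable_fun setT g ->
  (forall t, 0 <= g t) -> laplace (EFin \o g) x = A%:E ->
  mu.-integrable setT (EFin \o (fun t => g t * expR (- (x * t)))).
Proof.
move=> mg g0 gA; apply/integrableP; split.
  apply/measurable_EFinP; apply: measurable_funM => //.
  by have /measurable_EFinP := measurable_expR_lin x.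
rewrite (_ : integral _ _ _ = laplace (EFin \o g) x); first by rewrite gA ltry.
by rewrite /laplace; apply: eq_integral => t _; rewrite /= ger0_norm ?mulr_ge0 ?expR_ge0.
Qed.

Lemma laplace_lin (g h : R -> R) (sg x A B : R) :
  measurable_fun setT g -> measurable_fun setT h ->
  (forall t, 0 <= g t) -> (forall t, 0 <= h t) ->
  laplace (EFin \o g) x = A%:E -> laplace (EFin \o h) x = B%:E ->
  laplace (fun t => (sg * (g t - h t))%:E) x = (sg * (A - B))%:E.
Proof.
move=> mg mh g0 h0 gA hB.
have gi := integrable_laplace mg g0 gA.
have hi := integrable_laplace mh h0 hB.
have ghi : mu.-integrable setT
    (EFin \o (fun t => g t * expR (- (x * t)) - h t * expR (- (x * t)))).
  by have := integrableB measurableT gi hi; apply: eq_integrable => // t _.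
rewrite EFinM EFinB -gA -hB /laplace.
have <- := integralB_EFin measurableT gi hi.
have <- := integralZl measurableT ghi sg.
apply: eq_integral => t _ /=; rewrite -!EFinM; congr EFin; ring.
Qed.

Lemma measurable_tricomi_convolution (c a b : R) :
  measurable_fun setT (tricomi_convolution c a b).
Proof.
apply: measurable_convolution.
- exact: measurable_EFin_tricomi_density.
- exact: measurable_EFin_tricomi_density.
- exact: EFin_tricomi_density_ge0.
- exact: EFin_tricomi_density_ge0.
Qed.

Lemma sym_convolution_ge0 (c a b r : R) : (0 <= sym_convolution c a b r)%E.
Proof. by rewrite adde_ge0// tricomi_convolution_ge0. Qed.

Lemma sym_convolution_le0 (c a b r : R) : r <= 0 -> sym_convolution c a b r = 0%E.
Proof.
move=> r0; rewrite /sym_convolution !tricomi_convolution_itv.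
by rewrite set_itv_ge ?integral_set0 ?adde0// bnd_simp -leNgt.
Qed.

Lemma fine_sym_convolution (c a b r : R) : 0 < a -> 0 < b ->
  (fine (sym_convolution c a b r))%:E = sym_convolution c a b r.
Proof.
move=> a0 b0; have [r0|r0] := ltP 0 r; last by rewrite sym_convolution_le0.
rewrite fineK// ge0_fin_numE ?sym_convolution_ge0// lte_add_pinfty//;
  exact: tricomi_convolution_lty.
Qed.

Lemma laplace_sym_convolution (c a b x : R) : 0 < a -> 0 < b -> 0 < x ->
  laplace (EFin \o (fun r => fine (sym_convolution c a b r))) x =
  (2 * (tricomi_laplace c a x * tricomi_laplace c b x))%:E.
Proof.
move=> a0 b0 x0.
have E0 (u v t : R) : (0 <= tricomi_convolution c u v t * (expR (- (x * t)))%:E)%E.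
  by rewrite mule_ge0 ?tricomi_convolution_ge0// lee_fin expR_ge0.
have m (u v : R) := measurable_laplace_integrand x (measurable_tricomi_convolution c u v).
have L (u v : R) : 0 < u -> 0 < v -> laplace (tricomi_convolution c u v) x =
    (tricomi_laplace c u x * tricomi_laplace c v x)%:E.
  move=> u0 v0; rewrite laplace_convolution.
  - by rewrite !laplace_tricomi_density.
  - exact: measurable_EFin_tricomi_density.
  - exact: measurable_EFin_tricomi_density.
  - exact: EFin_tricomi_density_ge0.
  - exact: EFin_tricomi_density_ge0.
transitivity (laplace (tricomi_convolution c a b) x + laplace (tricomi_convolution c b a) x)%E.
  have <- := @ge0_integralD _ _ _ mu _ measurableT _ _ (fun t _ => E0 a b t) (m a b)
    (fun t _ => E0 b a t) (m b a).
  apply: eq_integral => t _; rewrite /= fine_sym_convolution//.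
  by rewrite ge0_muleDl ?tricomi_convolution_ge0.
have -> := L a b a0 b0; have -> := L b a b0 a0.
move: (tricomi_laplace c a x) (tricomi_laplace c b x) => u v.
by rewrite -EFinD; congr EFin; ring.
Qed.

(** The Tricomi function for [e = 0].  For [e = c] the normalization is the one
    that makes the function equivalent to [x^(- (al + c))] at 0. *)
Definition normalized_tricomi (e c al x : R) : R :=
  tricomi_laplace c al x / Gamma (al + e).

Lemma positive_laplace_transform_normalized (e c al : R) : 0 < al -> 0 < al + e ->
  positive_laplace_transform (normalized_tricomi e c al).
Proof.
move=> al0 ale.
have := positive_laplace_transformZ (k := (Gamma (al + e))^-1) _
  (positive_laplace_transform_tricomi c al0).
rewrite invr_gt0 Gamma_gt0// => /(_ isT).
by apply: eq_positive_laplace_transform => x _; rewrite mulrC.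
Qed.

Local Opaque sym_convolution.

Lemma laplace_normalized_sym_convolution (e c a b : R) (g : R -> R) :
  0 < a -> 0 < b -> 0 < a + e -> 0 < b + e ->
  (forall r, g r = fine (sym_convolution c a b r) / (Gamma (a + e) * Gamma (b + e))) ->
  [/\ measurable_fun setT g, forall r, 0 <= g r & forall x, 0 < x ->
    laplace (EFin \o g) x =
    (2 * (normalized_tricomi e c a x * normalized_tricomi e c b x))%:E].
Proof.
move=> a0 b0 ae be gE.
have [N NE] : exists N, N = Gamma (a + e) * Gamma (b + e) by eexists.
have N0 : 0 < N by rewrite NE mulr_gt0 ?Gamma_gt0.
have mS : measurable_fun setT (fun r => fine (sym_convolution c a b r)).
  apply: measurableT_comp => //.
  by apply: emeasurable_funD; exact: measurable_tricomi_convolution.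
have -> : g = (fun r => fine (sym_convolution c a b r) * N^-1).
  by apply/funext => r; rewrite gE NE.
split.
- by apply: measurable_funM => //; exact: measurable_cst.
- by move=> r; apply: mulr_ge0; rewrite ?invr_ge0 ?(ltW N0)// fine_ge0// sym_convolution_ge0.
- move=> x x0; have Lx := laplace_sym_convolution c a0 b0 x0.
  have gi := integrable_laplace mS (fun r => fine_ge0 (sym_convolution_ge0 c a b r)) Lx.
  transitivity (N^-1%:E * laplace (EFin \o (fun r => fine (sym_convolution c a b r))) x)%E.
    rewrite /laplace; have <- := integralZl measurableT gi N^-1.
    by apply: eq_integral => t _; rewrite /= -!EFinM mulrA (mulrC _ N^-1).
  rewrite Lx /normalized_tricomi -EFinM NE.
  move: (Gamma (a + e)) (Gamma (b + e)) => G H.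
  move: (tricomi_laplace c a x) (tricomi_laplace c b x) => u v.
  apply: congr1; rewrite invfM; ring.
Qed.

(** Half of [sg] times the difference of the normalized symmetrized convolutions
    is a density of this function, and it is positive by [sym_convolution_lt]. *)
Lemma pair_positive_laplace_transform (sg e c p1 p2 q1 q2 : R) :
  (e = 0 /\ 0 < sg * c) \/ (e = c /\ sg * c < 0) -> `|sg| = 1 ->
  p2 <= p1 -> p1 < q1 -> p1 + p2 = q1 + q2 ->
  0 < p2 -> 0 < q2 -> 0 < p2 + e -> 0 < q2 + e ->
  positive_laplace_transform (fun x => sg *
    (normalized_tricomi e c p1 x * normalized_tricomi e c p2 x -
     normalized_tricomi e c q1 x * normalized_tricomi e c q2 x)).
Proof.
move=> ec sg1 p21 pq1 pq p20 q20 p2e q2e.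
have p10 : 0 < p1 by lra.
have q10 : 0 < q1 by lra.
have p1e : 0 < p1 + e by lra.
have q1e : 0 < q1 + e by lra.
have [gp gpE] : exists g : R -> R, forall r, g r =
    fine (sym_convolution c p1 p2 r) / (Gamma (p1 + e) * Gamma (p2 + e)).
  by eexists=> r; reflexivity.
have [gq gqE] : exists g : R -> R, forall r, g r =
    fine (sym_convolution c q1 q2 r) / (Gamma (q1 + e) * Gamma (q2 + e)).
  by eexists=> r; reflexivity.
have lt r : 0 < r -> sg * gq r < sg * gp r.
  move=> r0; have inc x y : 0 < x -> x < y ->
      sg * modulation e c r x < sg * modulation e c r y.
    by move=> x0 xy; exact: modulation_inc.
  have := sym_convolution_lt inc p21 pq1 pq p20 q20 p2e q2e r0.
  by rewrite gpE gqE.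
have [mp gp0 Lp] := laplace_normalized_sym_convolution p10 p20 p1e p2e gpE.
have [mq gq0 Lq] := laplace_normalized_sym_convolution q10 q20 q1e q2e gqE.
have Lfin (x : R) : 0 < x -> laplace (fun t => (sg * (gp t - gq t))%:E) x =
    (2 * (sg * (normalized_tricomi e c p1 x * normalized_tricomi e c p2 x -
     normalized_tricomi e c q1 x * normalized_tricomi e c q2 x)))%:E.
  move=> x0; rewrite (laplace_lin sg mp mq gp0 gq0 (Lp x x0) (Lq x x0)).
  move: (normalized_tricomi e c p1 x * _) => P.
  move: (normalized_tricomi e c q1 x * _) => Q.
  by rewrite -mulrBr mulrCA.
have f_gt0 t : 0 < t -> 0 < sg * (gp t - gq t) by move=> t0; rewrite mulrBr subr_gt0 lt.
have fN t : t <= 0 -> sg * (gp t - gq t) = 0.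
  by move=> t0; rewrite gpE gqE !sym_convolution_le0//= !mul0r subrr mulr0.
have mf : measurable_fun setT (fun t => (sg * (gp t - gq t))%:E).
  apply/measurable_EFinP; apply: measurable_funM; first exact: measurable_cst.
  exact: measurable_funB mp mq.
have f0 t : (0 <= (sg * (gp t - gq t))%:E)%E.
  by rewrite lee_fin; have [/f_gt0/ltW//|/fN->] := ltP 0 t.
apply: (@eq_positive_laplace_transform _ (fun x => 2^-1 * (2 * (sg *
    (normalized_tricomi e c p1 x * normalized_tricomi e c p2 x -
     normalized_tricomi e c q1 x * normalized_tricomi e c q2 x))))).
  by move=> x _; rewrite mulKf.
apply: positive_laplace_transformZ; first by rewrite invr_gt0.
exists (fun t => (sg * (gp t - gq t))%:E); split => //.
- by move=> t t0; rewrite fN.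
- move=> x x0; rewrite -lte_fin -Lfin//; apply: laplace_gt0 => //.
  by move=> t t0; rewrite fN.
Qed.

End pair_laplace.

(** * Majorization by transfers *)

Section majorization.
Variables (R : realType) (n : nat).
Implicit Types p q : 'rV[R]_n.

(** The entries [k] and [l] move towards each other by [d]. *)
Definition transfer q (k l : 'I_n) (d : R) : 'rV[R]_n :=
  \row_j (q 0 j + (if j == l then d else 0) - (if j == k then d else 0)).

Lemma sum_transfer q (k l : 'I_n) d (P : pred 'I_n) : P k -> P l ->
  \sum_(j < n | P j) transfer q k l d 0 j = \sum_(j < n | P j) q 0 j.
Proof.
move=> Pk Pl.
have one (i : 'I_n) : P i -> \sum_(j < n | P j) (if j == i then d else 0) = d.
  move=> Pi; rewrite (bigD1 i)//= eqxx big1 ?addr0// => j /andP[_ /negPf ->//].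
under eq_bigr do rewrite mxE.
by rewrite sumrB big_split/= !one// addrK.
Qed.

(** Majorization without the requirement that [q] be sorted, which transfers do
    not preserve. *)
Definition dominated p q : Prop :=
  (forall m : nat, \sum_(j < n | (j < m)%N) p 0 j <= \sum_(j < n | (j < m)%N) q 0 j) /\
  \sum_(j < n) p 0 j = \sum_(j < n) q 0 j.

(** [l] is the first index where [p] exceeds [q]: the partial sum up to [l]
    forces a surplus of [q] at some earlier [k]. *)
Lemma dominated_gap p q : dominated p q -> p != q ->
  exists k l : 'I_n, [/\ (k < l)%N, p 0 k < q 0 k, q 0 l < p 0 l &
    forall j : 'I_n, (j < l)%N -> p 0 j <= q 0 j].
Proof.
move=> [pq pqT] neq.
have [j0 hj0] : exists j, q 0 j < p 0 j.
  apply: contrapT => nex.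
  have le j : p 0 j <= q 0 j by rewrite leNgt; apply/negP => h; apply: nex; exists j.
  move/negP: neq; apply; apply/eqP/rowP => j.
  apply/eqP; rewrite eq_sym -subr_eq0; apply/eqP.
  have s0 : \sum_(j < n) (q 0 j - p 0 j) = 0 by rewrite sumrB pqT subrr.
  have ge0 (i : 'I_n) : true -> 0 <= q 0 i - p 0 i by rewrite subr_ge0 le.
  exact: (psumr_eq0P ge0 s0).
case: (@arg_minnP _ j0 (fun j => q 0 j < p 0 j) (fun j => j : nat) hj0) => l hl lmin.
have le (j : 'I_n) : (j < l)%N -> p 0 j <= q 0 j.
  move=> jl; rewrite leNgt; apply/negP => h.
  by have := lmin _ h; rewrite leqNgt jl.
suff [k [kl pk]] : exists k : 'I_n, (k < l)%N /\ p 0 k < q 0 k by exists k, l.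
apply: contrapT => nex.
have ge (j : 'I_n) : (j < l)%N -> q 0 j <= p 0 j.
  by move=> jl; rewrite leNgt; apply/negP => h; apply: nex; exists j.
have := pq l.+1; apply/negP; rewrite -ltNge.
rewrite (bigD1 l)//= [ltRHS](bigD1 l)//=; apply: ltr_leD => //.
apply: ler_sum => j /andP[jl jnl]; apply: ge.
by rewrite ltn_neqAle jnl.
Qed.

(** Transferring the smaller of the two gaps [q k - p k] and [p l - q l] makes one
    more entry of [q] agree with [p], so the number of disagreements decreases.
    Domination survives: before [l] the new vector is still at least [p]
    entrywise, and from [l] on the partial sums are unchanged.  Since [p] is sorted, the two
    entries do not cross. *)
Theorem transfer_induction (lo : R) (Rel : 'rV[R]_n -> 'rV[R]_n -> Prop) :
  (forall p q r, Rel p q -> Rel q r -> Rel p r) ->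
  (forall q k l d, k != l -> 0 < d -> q 0 l + d <= q 0 k - d ->
     (forall j, lo < q 0 j) -> Rel (transfer q k l d) q) ->
  forall p q, (forall i j : 'I_n, (i <= j)%N -> p 0 j <= p 0 i) ->
    dominated p q -> p != q -> (forall j, lo < q 0 j) -> Rel p q.
Proof.
move=> trans step p q pdec.
have [N] := ubnP #|[pred j | p 0 j != q 0 j]|.
elim: N q => // N IH q cardN pq neq qlo.
have [k [l [kl pk ql le]]] := dominated_gap pq neq.
have pkl : p 0 l <= p 0 k by apply: pdec; exact: ltnW.
pose d := Num.min (q 0 k - p 0 k) (p 0 l - q 0 l).
have d0 : 0 < d by rewrite lt_min !subr_gt0 pk.
have dk : d <= q 0 k - p 0 k by rewrite ge_min lexx.
have dl : d <= p 0 l - q 0 l by rewrite ge_min lexx orbT.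
have nkl : k != l by rewrite neq_ltn kl.
pose q' := transfer q k l d.
have q'k : q' 0 k = q 0 k - d by rewrite mxE eqxx (negPf nkl) addr0.
have q'l : q' 0 l = q 0 l + d by rewrite mxE eqxx eq_sym (negPf nkl) subr0.
have q'j j : j != k -> j != l -> q' 0 j = q 0 j.
  by move=> jk jl; rewrite mxE (negPf jk) (negPf jl) addr0 subr0.
have Rq : Rel q' q by apply: step => //; lra.
have [->//|neq'] := eqVneq p q'.
apply: (trans _ q') => //; apply: IH => //.
- rewrite -ltnS; apply: leq_trans cardN; rewrite ltnS; apply: proper_card.
  apply/properP; split.
    apply/fintype.subsetP => j; rewrite !inE.
    have [->|jk] := eqVneq j k; first by rewrite (lt_eqF pk).
    have [->|jl] := eqVneq j l; first by rewrite (gt_eqF ql).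
    by rewrite q'j.
  have [h|h] := leP (q 0 k - p 0 k) (p 0 l - q 0 l).
    exists k; rewrite inE ?(lt_eqF pk)// q'k negbK /d min_l//.
    by rewrite opprB addrC subrK.
  exists l; rewrite inE ?(gt_eqF ql)// q'l negbK /d min_r ?ltW//.
  by rewrite addrC subrK.
- split; last by rewrite sum_transfer//; case: pq.
  move=> m; have [ml|lm] := leqP m l; last first.
    by rewrite sum_transfer ?(ltn_trans kl)//; case: pq.
  apply: ler_sum => j jm; have jl : (j < l)%N by exact: leq_trans ml.
  have [->|jk] := eqVneq j k; first by rewrite q'k; lra.
  by rewrite q'j ?le// neq_ltn jl.
- move=> j; have [->|jk] := eqVneq j k; first by rewrite q'k; have := qlo l; lra.
  have [->|jl] := eqVneq j l; first by rewrite q'l; have := qlo l; lra.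
  by rewrite q'j.
Qed.

Lemma majorized_dominated p q : majorized p q -> dominated p q.
Proof.
move=> [_ _ _ part tot]; split; last by rewrite tot.
move=> m; have [m0|m0] := posnP m.
  by rewrite m0 !big_pred0.
have [mn|nm] := leqP m n.-1; first by apply: part; rewrite m0.
have all (j : 'I_n) : (j < m)%N by apply: leq_trans nm; rewrite ltnS -ltnS prednK ?(leq_trans _ (ltn_ord j)).
have E (x : 'rV[R]_n) : \sum_(j < n | (j < m)%N) x 0 j = \sum_(j < n) x 0 j.
  by apply: eq_bigl => j; rewrite all.
by rewrite !E tot.
Qed.

End majorization.

(** * Asymptotics at the ends of the half-line *)

Section asymptotics.
Variable R : realType.

(** The integrand of [x^(al+e)] times the Laplace transform, after the
    substitution of [t / x] for [t]. *)
Definition scaled_integrand (e c al x t : R) : R :=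
  tricomi_density 0 al t * (x `^ e * (1 + t / x) `^ c) * expR (- t).

Lemma measurable_scaled_integrand (e c al x : R) :
  measurable_fun setT (fun t => (scaled_integrand e c al x t)%:E).
Proof.
apply/measurable_EFinP; apply: measurable_funM; last first.
  by apply: measurableT_comp => //; exact: measurable_funN.
apply: measurable_funM; first exact: measurable_tricomi_density.
apply: measurable_funM; first exact: measurable_cst.
apply: (@measurableT_comp _ _ _ _ _ _ (@powR R ^~ c)) => //.
by apply: measurable_funD => //; exact: measurable_funM.
Qed.

Lemma tricomi_laplace_scaled (e c al x : R) : 0 < al -> 0 < x ->
  ((x `^ (al + e) * tricomi_laplace c al x)%:E =
   \int[mu]_t (scaled_integrand e c al x t)%:E)%E.
Proof.
move=> al0 x0; rewrite EFinM -laplace_tricomi_density// laplace_tricomi_density_scale//.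
rewrite muleA -EFinM.
have mk : measurable_fun setT
    (fun t : R => (tricomi_density c al (t / x))%:E * (expR (- t))%:E)%E.
  apply: emeasurable_funM.
    apply: (measurableT_comp (measurable_EFin_tricomi_density c al)).
    exact: measurable_funM.
  by apply/measurable_EFinP; apply: measurableT_comp => //; exact: measurable_funN.
have k0 (t : R) : (0 <= (tricomi_density c al (t / x))%:E * (expR (- t))%:E)%E.
  by rewrite mule_ge0 ?EFin_tricomi_density_ge0// lee_fin expR_ge0.
have x1 : (0 <= (x `^ (al + e) / x)%:E)%E by rewrite lee_fin divr_ge0 ?powR_ge0 ?ltW.
have <- := @ge0_integralZl _ _ _ mu _ measurableT _ mk _ (fun t _ => k0 t) x1.
apply: eq_integral => t _; rewrite -!EFinM; congr EFin.
rewrite /scaled_integrand mulrA; congr (_ * _).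
rewrite /tricomi_density; have [t0|t0] := ltP 0 t; last first.
  by rewrite ltNge mulr_le0_ge0 ?invr_ge0 ?(ltW x0)//= mulr0 mul0r.
rewrite divr_gt0// powRr0 mulr1 powRM ?(ltW t0) ?invr_ge0 ?(ltW x0)//.
have -> : x^-1 `^ (al - 1) = (x `^ (al - 1))^-1.
  by rewrite -powR_inv1 ?(ltW x0)// -powRrM mulN1r powRN.
have -> : x `^ (al + e) = x * x `^ (al - 1) * x `^ e.
  have -> : al + e = 1 + (al - 1) + e by ring.
  by rewrite !powRD ?(gt_eqF x0) ?implybT// powRr1 ?(ltW x0).
have : 0 < x `^ (al - 1) by rewrite powR_gt0.
move: (x `^ (al - 1)) (x `^ e) (t `^ _) (_ `^ c) => P Q T V P0.
by field; rewrite !gt_eqF.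
Qed.

(** Dominated convergence towards the integrand of [Gamma (al + e)].  The bound is
    the sum of two integrable densities, so as to cover both ends of the
    half-line and both signs of [c]. *)
Lemma cvg_normalized_tricomi (e c al : R) (x_ : nat -> R) :
  0 < al -> 0 < al + e -> (forall n, 0 < x_ n) ->
  (forall n t, 0 < t -> x_ n `^ e * (1 + t / x_ n) `^ c <= (1 + t) `^ `|c| * (1 + t `^ e)) ->
  (forall t, 0 < t -> x_ n `^ e * (1 + t / x_ n) `^ c @[n --> \oo] --> t `^ e) ->
  x_ n `^ (al + e) * normalized_tricomi e c al (x_ n) @[n --> \oo] --> (1 : R).
Proof.
move=> al0 ale xpos bnd ptw.
have G0 := Gamma_gt0 ale.
pose g (t : R) : \bar R := ((tricomi_density `|c| al t)%:E * (expR (- (1 * t)))%:E +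
  (tricomi_density `|c| (al + e) t)%:E * (expR (- (1 * t)))%:E)%E.
have lapi (b : R) : 0 < b -> mu.-integrable setT
    (fun t => (tricomi_density `|c| b t)%:E * (expR (- (1 * t)))%:E)%E.
  move=> b0; apply/integrableP; split.
    by apply: measurable_laplace_integrand; exact: measurable_EFin_tricomi_density.
  apply: le_lt_trans (laplace_tricomi_density_lty `|c| b0 ltr01).
  rewrite le_eqVlt; apply/orP; left; apply/eqP; apply: eq_integral => t _.
  by rewrite gee0_abs// mule_ge0 ?EFin_tricomi_density_ge0// lee_fin expR_ge0.
have gi : mu.-integrable setT g by apply: integrableD => //; exact: lapi.
pose f (t : R) : \bar R := ((tricomi_density 0 (al + e) t)%:E * (expR (- (1 * t)))%:E)%E.
have mf : measurable_fun setT f.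
  by apply: measurable_laplace_integrand; exact: measurable_EFin_tricomi_density.
have dens0 (t : R) : 0 < t -> tricomi_density 0 (al + e) t = tricomi_density 0 al t * t `^ e.
  move=> t0; rewrite !tricomi_density0// -powRD ?(gt_eqF t0) ?implybT//.
  by congr (_ `^ _); ring.
have f_f : {ae mu, forall t, setT t ->
    (scaled_integrand e c al (x_ n) t)%:E @[n --> \oo] --> f t}.
  apply: aeW => t _; apply/cvg_EFin; first exact: nearW.
  have [t0|t0] := ltP 0 t; last first.
    rewrite /f /scaled_integrand (tricomi_density_le0 _ (al + e) t0) mul0r/=.
    by under eq_fun do rewrite tricomi_density_le0// !mul0r; exact: cvg_cst.
  rewrite /f/= dens0// mul1r; apply: cvgMl; apply: cvgMr; exact: ptw.
have f_g : {ae mu, forall t n, setT t ->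
    (`|(scaled_integrand e c al (x_ n) t)%:E| <= g t)%E}.
  apply: aeW => t n _; rewrite /g -!EFinM -EFinD abse_EFin lee_fin mul1r.
  have [t0|t0] := ltP 0 t; last first.
    by rewrite /scaled_integrand !tricomi_density_le0// !mul0r normr0 addr0.
  rewrite ger0_norm; last by rewrite /scaled_integrand !mulr_ge0 ?expR_ge0 ?powR_ge0 ?tricomi_density_ge0.
  rewrite -mulrDl /scaled_integrand ler_pM2r ?expR_gt0//.
  have -> : tricomi_density `|c| al t + tricomi_density `|c| (al + e) t =
      tricomi_density 0 al t * ((1 + t) `^ `|c| * (1 + t `^ e)).
    have -> : tricomi_density `|c| (al + e) t = tricomi_density 0 (al + e) t * (1 + t) `^ `|c|.
      by rewrite /tricomi_density t0 powRr0 mulr1.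
    have -> : tricomi_density `|c| al t = tricomi_density 0 al t * (1 + t) `^ `|c|.
      by rewrite /tricomi_density t0 powRr0 mulr1.
    rewrite dens0//; ring.
  by apply: ler_wpM2l; [exact: tricomi_density_ge0|exact: bnd].
have [_ _ lim] := @dominated_convergence _ _ _ mu _ measurableT _ _ _
  (fun n => measurable_scaled_integrand e c al (x_ n)) mf f_f gi f_g.
have limE : (x_ n `^ (al + e) * tricomi_laplace c al (x_ n))%:E @[n --> \oo] -->
    (Gamma (al + e))%:E.
  rewrite GammaE -laplace_tricomi_density//.
  by under eq_fun do rewrite tricomi_laplace_scaled//.
have limR : x_ n `^ (al + e) * tricomi_laplace c al (x_ n) @[n --> \oo] --> Gamma (al + e).
  exact: (fine_cvg limE).
have Gn0 : Gamma (al + e) != 0 by rewrite gt_eqF.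
rewrite /normalized_tricomi -(divff Gn0).
under eq_fun do rewrite mulrA.
exact: cvgMl.
Qed.

(** Along [x = n + 1] the factor [(1 + t/x)^c] tends to 1; along [x = 1/(n+1)] the
    factor [x^c (1 + t/x)^c = (x + t)^c] tends to [t^c]. *)
Lemma exists_scale (e c : R) : e = 0 \/ e = c ->
  exists x_ : nat -> R, (forall n, 0 < x_ n) /\
    forall al, 0 < al -> 0 < al + e ->
    x_ n `^ (al + e) * normalized_tricomi e c al (x_ n) @[n --> \oo] --> (1 : R).
Proof.
have inv_cvg : (n.+1%:R^-1 : R) @[n --> \oo] --> (0 : R) by exact: cvg_harmonic.
case=> ->.
- exists (fun n => n.+1%:R); split => // al al0 ale.
  apply: cvg_normalized_tricomi => //.
  + move=> n t t0; rewrite !powRr0 mul1r.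
    have n1 : 1 <= n.+1%:R :> R by rewrite ler1n.
    have tn : 0 <= t / n.+1%:R by rewrite divr_ge0// ltW.
    have tnt : t / n.+1%:R <= t by rewrite ler_pdivrMr// ler_peMr// ltW.
    have le1 : (1 + t / n.+1%:R) `^ c <= (1 + t) `^ `|c|.
      apply: (@le_trans _ _ ((1 + t / n.+1%:R) `^ `|c|)).
        by rewrite ler_powR ?ler_norm// lerDl.
      by apply: ge0_ler_powR; rewrite ?nnegrE ?lerD2l ?addr_ge0// ltW.
    by apply: (le_trans le1); rewrite ler_peMr ?powR_ge0// lerDl.
  + move=> t t0; rewrite powRr0; under eq_fun do rewrite powRr0 mul1r.
    have h : 1 + t / n.+1%:R @[n --> \oo] --> (1 : R).
      rewrite -[X in _ --> X]addr0 -(mulr0 t); apply: cvgD; first exact: cvg_cst.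
      exact: cvgMr.
    have h2 : (1 + t / n.+1%:R) `^ c @[n --> \oo] --> (1 : R) `^ c.
      exact: (cvg_comp _ _ h (@continuous_powR R c 1 ltr01)).
    by rewrite powR1 in h2.
- exists (fun n => n.+1%:R^-1); split; first by move=> n; rewrite invr_gt0.
  move=> al al0 ale.
  have E n (t : R) : 0 < t -> (n.+1%:R^-1 : R) `^ c * (1 + t / n.+1%:R^-1) `^ c =
      (n.+1%:R^-1 + t) `^ c.
    move=> t0; rewrite -powRM ?invr_ge0//; last first.
      by rewrite addr_ge0// divr_ge0 ?invr_ge0// ltW.
    by congr (_ `^ _); field.
  apply: cvg_normalized_tricomi => //.
  + move=> n t t0; rewrite E//.
    have n0 : 0 < n.+1%:R^-1 :> R by rewrite invr_gt0.
    have n1 : n.+1%:R^-1 <= 1 :> R by rewrite invf_le1 ?ler1n.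
    have [c0|c0] := leP 0 c.
      apply: (@le_trans _ _ ((1 + t) `^ `|c|)).
        by rewrite ger0_norm//; apply: ge0_ler_powR;
          rewrite ?nnegrE ?lerD2r ?addr_ge0 ?(ltW t0) ?(ltW n0).
      by rewrite ler_peMr ?powR_ge0// lerDl powR_ge0.
    apply: (@le_trans _ _ (t `^ c)).
      have F (z : R) : z `^ c = (z `^ (- c))^-1 by rewrite powRN invrK.
      rewrite !F lef_pV2 ?posrE ?powR_gt0 ?addr_gt0//.
      by apply: ge0_ler_powR; rewrite ?nnegrE ?oppr_ge0 ?lerDr ?addr_ge0
        ?(ltW t0) ?(ltW n0) ?(ltW c0).
    apply: (@le_trans _ _ (1 + t `^ c)); first by rewrite lerDr.
    rewrite ler_peMl//; first by rewrite addr_ge0// powR_ge0.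
    by rewrite -[leLHS](powRr0 (1 + t)) ler_powR// lerDl ltW.
  + move=> t t0; under eq_fun do rewrite E//.
    have h : n.+1%:R^-1 + t @[n --> \oo] --> t.
      by rewrite -[X in _ --> X]add0r; apply: cvgD => //; exact: cvg_cst.
    exact: (cvg_comp _ _ h (@continuous_powR R c t t0)).
Qed.

End asymptotics.

(** * Products of n Tricomi functions *)

Section products.
Variable R : realType.

Lemma positive_laplace_transform_prod (I : Type) (r : seq I) (P : pred I)
    (G : R -> R) (F : I -> R -> R) : positive_laplace_transform G ->
  (forall i, positive_laplace_transform (F i)) ->
  positive_laplace_transform (fun x => G x * \prod_(i <- r | P i) F i x).
Proof.
move=> hG hF; elim: r => [|i r IH].
  by apply: eq_positive_laplace_transform hG => x _; rewrite big_nil mulr1.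
have [Pi|nPi] := boolP (P i).
  apply: eq_positive_laplace_transform (positive_laplace_transformM (hF i) IH) => x _.
  by rewrite big_cons Pi mulrCA.
by apply: eq_positive_laplace_transform IH => x _; rewrite big_cons (negPf nPi).
Qed.

Local Opaque normalized_tricomi.

Variables (n : nat) (a e c sg : R).
Hypothesis ec : (e = 0 /\ 0 < sg * c) \/ (e = c /\ sg * c < 0).
Hypothesis sg1 : `|sg| = 1.
Implicit Types p q : 'rV[R]_n.

Definition normalized_product p x : R :=
  \prod_(j < n) normalized_tricomi e c (a + p 0 j) x.

(** The bound says that [a + p 0 j] and [a + p 0 j + e] are positive; a single
    lower bound is the form that [transfer_induction] propagates. *)
Definition admissible p := forall j, Num.max (- a) (- a - e) < p 0 j.

Lemma admissible_gt0 p j : admissible p -> 0 < a + p 0 j /\ 0 < a + p 0 j + e.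
Proof. by move=> /(_ j); rewrite gt_max => /andP[h1 h2]; split; lra. Qed.

Lemma transfer_admissible q (k l : 'I_n) d :
  0 < d -> q 0 l + d <= q 0 k - d -> admissible q -> admissible (transfer q k l d).
Proof.
move=> d0 ql adm j; rewrite mxE.
have := adm j; have := adm l; have := ltW d0.
by case: eqVneq => [->|_]; case: eqVneq => [->|_] /=; rewrite ?addr0 ?subr0; lra.
Qed.

Lemma majorized_admissible p q : majorized p q -> admissible q -> admissible p.
Proof.
move=> pq adm; have [qp _ pdec _ _] := pq.
have trans (u v w : 'rV[R]_n) : admissible u -> admissible v -> admissible u by [].
have neq : p != q by apply/eqP => pqE; exact: qp.
apply: (transfer_induction (Rel := fun u _ => admissible u) trans _ pdec
  (majorized_dominated pq) neq adm).
by move=> u k l d _; exact: transfer_admissible.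
Qed.

(** Only two factors change, so the difference is a two-factor difference times
    the common remaining factors. *)
Lemma transfer_positive_laplace_transform q (k l : 'I_n) d :
  k != l -> 0 < d -> q 0 l + d <= q 0 k - d -> admissible q ->
  positive_laplace_transform (fun x =>
    sg * (normalized_product (transfer q k l d) x - normalized_product q x)).
Proof.
move=> kl d0 ql adm.
set q' := transfer q k l d.
have q'k : q' 0 k = q 0 k - d by rewrite mxE eqxx (negPf kl) addr0.
have q'l : q' 0 l = q 0 l + d by rewrite mxE eqxx eq_sym (negPf kl) subr0.
have q'j j : j != k -> j != l -> q' 0 j = q 0 j.
  by move=> jk jl; rewrite mxE (negPf jk) (negPf jl) addr0 subr0.
have [ak ake] := admissible_gt0 k adm.
have [al ale] := admissible_gt0 l adm.
have pair : positive_laplace_transform (fun x => sg *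
    (normalized_tricomi e c (a + q' 0 k) x * normalized_tricomi e c (a + q' 0 l) x -
     normalized_tricomi e c (a + q 0 k) x * normalized_tricomi e c (a + q 0 l) x)).
  by rewrite q'k q'l; apply: pair_positive_laplace_transform => //; lra.
have := positive_laplace_transform_prod (index_enum 'I_n)
  (fun j => (j != k) && (j != l)) (F := fun j => normalized_tricomi e c (a + q 0 j)) pair.
have hF j : positive_laplace_transform (normalized_tricomi e c (a + q 0 j)).
  by have [? ?] := admissible_gt0 j adm; exact: positive_laplace_transform_normalized.
move=> /(_ hF); apply: eq_positive_laplace_transform => x _.
have split_prod (u : 'rV[R]_n) : normalized_product u x =
    normalized_tricomi e c (a + u 0 k) x * normalized_tricomi e c (a + u 0 l) x *
    \prod_(j < n | (j != k) && (j != l)) normalized_tricomi e c (a + u 0 j) x.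
  by rewrite /normalized_product (bigD1 k)//= (bigD1 l) 1?eq_sym//= mulrA.
rewrite !split_prod.
have -> : \prod_(j < n | (j != k) && (j != l)) normalized_tricomi e c (a + q' 0 j) x =
    \prod_(j < n | (j != k) && (j != l)) normalized_tricomi e c (a + q 0 j) x.
  by apply: eq_bigr => j /andP[jk jl]; rewrite q'j.
move: (\prod_(j < n | _) _) (normalized_tricomi e c (a + q' 0 k) x)
  (normalized_tricomi e c (a + q' 0 l) x) (normalized_tricomi e c (a + q 0 k) x)
  (normalized_tricomi e c (a + q 0 l) x) => rest u1 u2 v1 v2.
by rewrite -mulrBl mulrA.
Qed.

Lemma majorized_positive_laplace_transform p q : majorized p q -> admissible q ->
  positive_laplace_transform (fun x =>
    sg * (normalized_product p x - normalized_product q x)).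
Proof.
move=> pq adm; have [qp _ pdec _ _] := pq.
pose Rel u v := positive_laplace_transform (fun x =>
  sg * (normalized_product u x - normalized_product v x)).
have trans u v w : Rel u v -> Rel v w -> Rel u w.
  move=> uv vw.
  apply: eq_positive_laplace_transform (positive_laplace_transformD uv vw) => x _.
  move: (normalized_product u x) (normalized_product v x) (normalized_product w x).
  by move=> U V W; ring.
have step (u : 'rV[R]_n) (k l : 'I_n) (d : R) : k != l -> 0 < d ->
    u 0 l + d <= u 0 k - d -> admissible u -> Rel (transfer u k l d) u.
  exact: transfer_positive_laplace_transform.
have neq : p != q by apply/eqP => pqE; exact: qp.
exact: (transfer_induction trans step pdec (majorized_dominated pq) neq adm).
Qed.

(** The powers of [x] in the numerator and in the denominator cancel because [p]
    and [q] have the same sum. *)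
Lemma cvg_normalized_ratio p q : admissible p -> admissible q ->
  \sum_(j < n) q 0 j = \sum_(j < n) p 0 j ->
  exists x_ : nat -> R, (forall k, 0 < x_ k) /\
    normalized_product p (x_ k) / normalized_product q (x_ k) @[k --> \oo] --> (1 : R).
Proof.
move=> admp admq pq.
have ec' : e = 0 \/ e = c by case: ec => -[-> _]; [left|right].
have [x_ [x0 hx]] := exists_scale ec'.
exists x_; split => //.
have lim u : admissible u -> \prod_(j < n) (x_ k `^ (a + u 0 j + e) *
    normalized_tricomi e c (a + u 0 j) (x_ k)) @[k --> \oo] --> (1 : R).
  move=> adm; have : forall s : seq 'I_n, \prod_(j <- s) (x_ k `^ (a + u 0 j + e) *
      normalized_tricomi e c (a + u 0 j) (x_ k)) @[k --> \oo] --> (1 : R).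
    elim=> [|j s IH].
      by under eq_fun do rewrite big_nil; exact: cvg_cst.
    under eq_fun do rewrite big_cons.
    have [h1 h2] := admissible_gt0 j adm.
    by have := cvgM (hx _ h1 h2) IH; rewrite mulr1; exact.
  exact.
have E (u : 'rV[R]_n) (x : R) : 0 < x -> \prod_(j < n) (x `^ (a + u 0 j + e) *
    normalized_tricomi e c (a + u 0 j) x) =
    x `^ (\sum_(j < n) (a + e) + \sum_(j < n) u 0 j) * normalized_product u x.
  move=> xp; rewrite big_split/=; congr (_ * _).
  rewrite -big_split/=.
  elim/big_rec2: _ => [|j y z _ ->]; first by rewrite powRr0.
  rewrite -powRD ?(gt_eqF xp) ?implybT//; congr (_ `^ _); ring.
have lim2 := cvgM (lim p admp) (cvgV (oner_neq0 R) (lim q admq)).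
rewrite invr1 mulr1 in lim2.
have EE : (fun k => normalized_product p (x_ k) / normalized_product q (x_ k)) =
  (fun k => \prod_(j < n) (x_ k `^ (a + p 0 j + e) *
    normalized_tricomi e c (a + p 0 j) (x_ k))) \* (fun k =>
    (\prod_(j < n) (x_ k `^ (a + q 0 j + e) *
    normalized_tricomi e c (a + q 0 j) (x_ k)))^-1).
  apply/funext => k /=; rewrite (E p _ (x0 k)) (E q _ (x0 k)) pq.
  have : 0 < x_ k `^ (\sum_(j < n) (a + e) + \sum_(j < n) p 0 j) by rewrite powR_gt0.
  move: (_ `^ _) (normalized_product p _) (normalized_product q _) => X P Q X0.
  by rewrite invfM mulrACA divff ?mul1r// gt_eqF.
by rewrite EE; exact: lim2.
Qed.

End products.

Section sharpness.
Variable R : realType.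
Implicit Types f g r : R -> R.

Lemma cm_ge0 f : completely_monotonic_on `]0, +oo[ f -> forall x, 0 < x -> 0 <= f x.
Proof.
move=> cm x x0; have xI : `]0, +oo[%classic x by rewrite /= in_itv/= x0.
by have [_] := cm 0%N x xI; rewrite expr0 mul1r derive1n0.
Qed.

Section lower.
Variables (f g r : R -> R) (lam : R) (x_ : nat -> R).
Hypothesis hr : forall x : R, 0 < x -> r x = f x / g x.
Hypothesis hg : positive_laplace_transform g.
Hypothesis x0 : forall n, 0 < x_ n.
Hypothesis hlim : r (x_ n) @[n --> \oo] --> lam.

Let g_gt0 (x : R) : 0 < x -> 0 < g x.
Proof. by case: hg => ? [_ _ _ _]; apply. Qed.

(** At the critical constant the difference is a Laplace transform; below it a
    positive multiple of [g] is added.  Conversely, nonnegativity bounds [rho] by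
    every value of the ratio, hence by its limit. *)
Lemma sharp_lower_laplace : positive_laplace_transform (fun x => f x - lam * g x) ->
  (forall rho, completely_monotonic_on `]0, +oo[ (fun x => f x - rho * g x) <->
     rho <= lam) /\ sharp_lower_bound_on `]0, +oo[ lam r.
Proof.
move=> hfg.
have lim_ge c' : (forall x, 0 < x -> c' <= r x) -> c' <= lam.
  move=> h; apply: (cvgr_to_ge hlim); apply: nearW => k; exact: h.
split.
  move=> rho; split => [cm|].
    apply: lim_ge => x xp; rewrite hr// ler_pdivlMr ?g_gt0//.
    by have := cm_ge0 cm xp; rewrite subr_ge0.
  rewrite le_eqVlt => /predU1P[->|rl]; first exact: positive_laplace_transform_cm.
  apply: positive_laplace_transform_cm.
  have rl' : 0 < lam - rho by rewrite subr_gt0.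
  apply: eq_positive_laplace_transform (positive_laplace_transformD hfg
    (positive_laplace_transformZ rl' hg)) => x _.
  ring.
split=> [x|c' h].
  rewrite /= in_itv/= andbT => xp; rewrite hr// ltr_pdivlMr ?g_gt0// -subr_gt0.
  by case: hfg => ? [_ _ _ _]; apply.
by apply: lim_ge => x xp; apply/ltW/h; rewrite /= in_itv/= xp.
Qed.

Lemma sharp_upper_laplace : positive_laplace_transform (fun x => lam * g x - f x) ->
  (forall rho, completely_monotonic_on `]0, +oo[ (fun x => - (f x - rho * g x)) <->
     lam <= rho) /\ sharp_upper_bound_on `]0, +oo[ lam r.
Proof.
move=> hfg.
have lim_le c' : (forall x, 0 < x -> r x <= c') -> lam <= c'.
  move=> h; apply: (cvgr_to_le hlim); apply: nearW => k; exact: h.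
split.
  move=> rho; split => [cm|].
    apply: lim_le => x xp; rewrite hr// ler_pdivrMr ?g_gt0//.
    by have := cm_ge0 cm xp; rewrite opprB subr_ge0.
  have fE rho' : (fun x => - (f x - rho' * g x)) = (fun x => rho' * g x - f x).
    by apply/funext => x; rewrite opprB.
  rewrite fE le_eqVlt => /predU1P[<-|rl]; first exact: positive_laplace_transform_cm.
  apply: positive_laplace_transform_cm.
  have rl' : 0 < rho - lam by rewrite subr_gt0.
  apply: eq_positive_laplace_transform (positive_laplace_transformD hfg
    (positive_laplace_transformZ rl' hg)) => x _.
  ring.
split=> [x|c' h].
  rewrite /= in_itv/= andbT => xp; rewrite hr// ltr_pdivrMr ?g_gt0// -subr_gt0.
  by case: hfg => ? [_ _ _ _]; apply.
by apply: lim_le => x xp; apply/ltW/h; rewrite /= in_itv/= xp.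
Qed.

End lower.
End sharpness.

(** * Sharp constants *)

Lemma positive_laplace_transform_normalized_product (R : realType) (n : nat)
    (a e c : R) (u : 'rV[R]_n) : (0 < n)%N -> admissible a e u ->
  positive_laplace_transform (normalized_product a e c u).
Proof.
case: n u => // n u _ adm.
have hF j : positive_laplace_transform (normalized_tricomi e c (a + u 0 j)).
  by have [? ?] := admissible_gt0 j adm; exact: positive_laplace_transform_normalized.
have := positive_laplace_transform_prod (index_enum 'I_n) xpredT (hF ord0)
  (fun i => hF (lift ord0 i)).
by apply: eq_positive_laplace_transform => x _; rewrite /normalized_product big_ord_recl.
Qed.

Section tricomi_products.
Variables (R : realType) (n : nat) (a b e : R) (p q : 'rV[R]_n).
Hypothesis admp : admissible a e p.
Hypothesis admq : admissible a e q.
Definition gamma_ratio (u : 'rV[R]_n) : R :=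
  \prod_(j < n) (Gamma (a + u 0 j + e) / Gamma (a + u 0 j)).

Definition tricomi_limit : R :=
  \prod_(j < n) ((Gamma (a + p 0 j + e) * Gamma (a + q 0 j)) /
                 (Gamma (a + q 0 j + e) * Gamma (a + p 0 j))).

Lemma gamma_ratio_gt0 (u : 'rV[R]_n) : admissible a e u -> 0 < gamma_ratio u.
Proof.
move=> adm; apply: prodr_gt0 => j _; have [h1 h2] := admissible_gt0 j adm.
by rewrite divr_gt0 ?Gamma_gt0.
Qed.

Lemma tricomi_productE (u : 'rV[R]_n) (x : R) : admissible a e u ->
  \prod_(j < n) tricomiU (a + u 0 j) (b + u 0 j) x =
  gamma_ratio u * normalized_product a e (b - a - 1) u x.
Proof.
move=> adm; rewrite -big_split/=; apply: eq_bigr => j _.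
have [h1 h2] := admissible_gt0 j adm.
have g1 := Gamma_gt0 h1; have g2 := Gamma_gt0 h2.
rewrite tricomiUE /normalized_tricomi.
have -> : b + u 0 j - (a + u 0 j) - 1 = b - a - 1 by ring.
move: (Gamma (a + u 0 j + e)) (Gamma (a + u 0 j)) (tricomi_laplace _ _ _) g1 g2.
by move=> G1 G2 W g1 g2; field; rewrite !gt_eqF.
Qed.

Lemma tricomi_limitE : tricomi_limit = gamma_ratio p / gamma_ratio q.
Proof.
rewrite /tricomi_limit /gamma_ratio -prodf_div; apply: eq_bigr => j _.
have [p1 p2] := admissible_gt0 j admp; have [q1 q2] := admissible_gt0 j admq.
have := Gamma_gt0 q2; have := Gamma_gt0 q1; have := Gamma_gt0 p1.
move: (Gamma (a + p 0 j + e)) (Gamma (a + q 0 j + e)) (Gamma (a + p 0 j)) (Gamma (a + q 0 j)).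
by move=> P2 Q2 P1 Q1 h1 h2 h3; field; rewrite !gt_eqF.
Qed.

Lemma tricomi_ratioE (x : R) : tricomi_ratio a b p q x =
  \prod_(j < n) tricomiU (a + p 0 j) (b + p 0 j) x /
  \prod_(j < n) tricomiU (a + q 0 j) (b + q 0 j) x.
Proof. by rewrite /tricomi_ratio prodf_div. Qed.

Let f x := \prod_(j < n) tricomiU (a + p 0 j) (b + p 0 j) x.
Let g x := \prod_(j < n) tricomiU (a + q 0 j) (b + q 0 j) x.

Lemma tricomi_ratio_cvg sg : (e = 0 /\ 0 < sg * (b - a - 1)) \/
    (e = b - a - 1 /\ sg * (b - a - 1) < 0) ->
  \sum_(j < n) q 0 j = \sum_(j < n) p 0 j ->
  exists x_ : nat -> R, (forall k, 0 < x_ k) /\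
    tricomi_ratio a b p q (x_ k) @[k --> \oo] --> tricomi_limit.
Proof.
move=> ec pq; have [x_ [x0 lim]] := cvg_normalized_ratio ec admp admq pq.
exists x_; split => //.
have -> : (fun k => tricomi_ratio a b p q (x_ k)) = (fun k => tricomi_limit *
    (normalized_product a e (b - a - 1) p (x_ k) /
     normalized_product a e (b - a - 1) q (x_ k))).
  apply/funext => k; rewrite tricomi_ratioE !tricomi_productE// tricomi_limitE.
  by rewrite invfM mulrACA.
by have := cvgMr (a := tricomi_limit) lim; rewrite mulr1; exact.
Qed.

Hypothesis n0 : (0 < n)%N.
Hypothesis pq : majorized p q.

Let sum_pq : \sum_(j < n) q 0 j = \sum_(j < n) p 0 j.
Proof. by case: pq. Qed.

Let g_laplace : positive_laplace_transform g.
Proof.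
have := positive_laplace_transformZ (gamma_ratio_gt0 admq)
  (positive_laplace_transform_normalized_product (b - a - 1) n0 admq).
by apply: eq_positive_laplace_transform => x _; rewrite /g tricomi_productE.
Qed.

Let scaled_diff sg x : gamma_ratio p * (sg *
    (normalized_product a e (b - a - 1) p x - normalized_product a e (b - a - 1) q x)) =
  sg * (f x - tricomi_limit * g x).
Proof.
rewrite /f /g !tricomi_productE// tricomi_limitE.
have := gamma_ratio_gt0 admq.
move: (gamma_ratio p) (gamma_ratio q) (normalized_product _ _ _ p x)
  (normalized_product _ _ _ q x) => A B P Q B0.
by field; rewrite gt_eqF.
Qed.

(** The normalized products are compared with constant 1; the constant
    [tricomi_limit] collects the Gamma factors of the normalization. *)
Lemma tricomi_sharp_lower :
  (e = 0 /\ 0 < b - a - 1) \/ (e = b - a - 1 /\ b - a - 1 < 0) ->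
  (forall rho, completely_monotonic_on `]0, +oo[ (tricomi_diff a b p q rho) <->
     rho <= tricomi_limit) /\
  sharp_lower_bound_on `]0, +oo[ tricomi_limit (tricomi_ratio a b p q).
Proof.
move=> ec.
have ec1 : (e = 0 /\ 0 < 1 * (b - a - 1)) \/ (e = b - a - 1 /\ 1 * (b - a - 1) < 0).
  by rewrite mul1r.
have [x_ [x0 lim]] := tricomi_ratio_cvg ec1 sum_pq.
have pos := majorized_positive_laplace_transform ec1 (normr1 R) pq admq.
apply: (@sharp_lower_laplace R f g (tricomi_ratio a b p q) tricomi_limit x_) => //.
- by move=> x _; exact: tricomi_ratioE.
- apply: eq_positive_laplace_transform
    (positive_laplace_transformZ (gamma_ratio_gt0 admp) pos) => x _.
  by rewrite scaled_diff mul1r.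
Qed.

Lemma tricomi_sharp_upper :
  (e = 0 /\ b - a - 1 < 0) \/ (e = b - a - 1 /\ 0 < b - a - 1) ->
  (forall rho, completely_monotonic_on `]0, +oo[ (fun x => - tricomi_diff a b p q rho x) <->
     tricomi_limit <= rho) /\
  sharp_upper_bound_on `]0, +oo[ tricomi_limit (tricomi_ratio a b p q).
Proof.
move=> ec.
have ec1 : (e = 0 /\ 0 < -1 * (b - a - 1)) \/ (e = b - a - 1 /\ -1 * (b - a - 1) < 0).
  by rewrite mulN1r oppr_gt0 oppr_lt0.
have [x_ [x0 lim]] := tricomi_ratio_cvg ec1 sum_pq.
have pos := majorized_positive_laplace_transform ec1 (normrN1 R) pq admq.
apply: (@sharp_upper_laplace R f g (tricomi_ratio a b p q) tricomi_limit x_) => //.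
- by move=> x _; exact: tricomi_ratioE.
- apply: eq_positive_laplace_transform
    (positive_laplace_transformZ (gamma_ratio_gt0 admp) pos) => x _.
  by rewrite scaled_diff mulN1r opprB.
Qed.

End tricomi_products.

Lemma tricomi_limit0 (R : realType) (n : nat) (a : R) (p q : 'rV[R]_n) :
  (forall j, - a < p 0 j) -> (forall j, - a < q 0 j) -> tricomi_limit a 0 p q = 1.
Proof.
move=> hp hq; rewrite /tricomi_limit big1// => j _.
have gp : 0 < Gamma (a + p 0 j) by apply: Gamma_gt0; have := hp j; lra.
have gq : 0 < Gamma (a + q 0 j) by apply: Gamma_gt0; have := hq j; lra.
by rewrite !addr0 [X in _ / X]mulrC divff// mulf_neq0// gt_eqF.
Qed.

Lemma tricomi_limit_shift (R : realType) (n : nat) (a b : R) (p q : 'rV[R]_n) :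
  tricomi_limit a (b - a - 1) p q = lambda_star a b p q.
Proof.
apply: eq_bigr => j _.
have -> : a + p 0 j + (b - a - 1) = b + p 0 j - 1 by ring.
by have -> : a + q 0 j + (b - a - 1) = b + q 0 j - 1 by ring.
Qed.

Theorem proposition5 (R : realType) (n : nat) (a b : R) (p q : 'rV[R]_n)
    (hn : (2 <= n)%N)
    (hp : forall j, - a < p 0 j) (hq : forall j, - a < q 0 j)
    (hpq : majorized p q) :
  (* (i) *)
  (0 < a -> 1 < b ->
     (* 0 < b + q_j - 1 puts the arguments of Gamma in lambda_star in its
        domain (0, +oo); it is automatic when a - b + 1 < 0, and passes
        to p by majorization *)
     (0 < a - b + 1 -> (forall j, 0 < b + q 0 j - 1) ->
        (forall rho : R,
           completely_monotonic_on `]0, +oo[ (tricomi_diff a b p q rho) <->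
           rho <= lambda_star a b p q) /\
        sharp_lower_bound_on `]0, +oo[
          (lambda_star a b p q) (tricomi_ratio a b p q)) /\
     (a - b + 1 < 0 ->
        (forall rho : R,
           completely_monotonic_on `]0, +oo[
             (fun x => - tricomi_diff a b p q rho x) <->
           lambda_star a b p q <= rho) /\
        sharp_upper_bound_on `]0, +oo[
          (lambda_star a b p q) (tricomi_ratio a b p q))) /\
  (* (ii) *)
  (0 < a ->
     (0 < a - b + 1 ->
        (forall rho : R,
           completely_monotonic_on `]0, +oo[
             (fun x => - tricomi_diff a b p q rho x) <->
           1 <= rho) /\
        sharp_upper_bound_on `]0, +oo[ 1 (tricomi_ratio a b p q)) /\
     (a - b + 1 < 0 ->
        (forall rho : R,
           completely_monotonic_on `]0, +oo[ (tricomi_diff a b p q rho) <->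
           rho <= 1) /\
        sharp_lower_bound_on `]0, +oo[ 1 (tricomi_ratio a b p q))).
Proof.
have n0 : (0 < n)%N by exact: ltnW.
have adm0 (u : 'rV[R]_n) : (forall j, - a < u 0 j) -> admissible a 0 u.
  by move=> h j; rewrite subr0 maxxx.
have admc : (forall j, 0 < b + q 0 j - 1) -> admissible a (b - a - 1) q.
  by move=> h j; rewrite gt_max hq; have := h j; lra.
have ap0 := adm0 _ hp; have aq0 := adm0 _ hq.
split.
- move=> _ _; rewrite -tricomi_limit_shift; split.
    move=> c0 hb; have aq := admc hb.
    apply: (tricomi_sharp_lower (majorized_admissible hpq aq) aq n0 hpq).
    by right; split => //; lra.
  move=> c0.
  have aq : admissible a (b - a - 1) q by apply: admc => j; have := hq j; lra.
  apply: (tricomi_sharp_upper (majorized_admissible hpq aq) aq n0 hpq).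
  by right; split => //; lra.
- move=> _; split => c0; rewrite -(tricomi_limit0 hp hq).
    by apply: (tricomi_sharp_upper ap0 aq0 n0 hpq); left; split => //; lra.
  by apply: (tricomi_sharp_lower ap0 aq0 n0 hpq); left; split => //; lra.
Qed.
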